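(* Let $d, n$ be positive integers with $d \ge 2$ and $n < \frac{d}{3}$. There does not exist a (measurable) function $F : (\mathbb{R}^d)^n \to \{0,1,2\}$ such that for every symmetric positive semi-definite real $d \times d$ matrix $A$ (not necessarily invertible) one has $$ \mathbb{P}\left( F(A^{1/2} X_1, \dots, A^{1/2} X_n) = \operatorname{rank}(C_E(A)) \right) > 0.9, $$ where $X_1, \dots, X_n$ are independent standard Gaussian random vectors in $\mathbb{R}^d$.
   Context: Let $e_1,\dots,e_d$ be the standard basis of $\mathbb{R}^d$ and let $E = \operatorname{span}\{e_1, e_2\}$. Let $B_d$ denote the closed Euclidean unit ball of $\mathbb{R}^d$. For a symmetric positive semi-definite matrix $A$, $A^{1/2}$ denotes its symmetric positive semi-definite square root, so that if $X$ is a standard Gaussian vector in $\mathbb{R}^d$ (law $N(0, \mathrm{Id})$) then $A^{1/2}X$ is a centered Gaussian vector with covariance matrix $A$. The set $A^{1/2} B_d \cap E$, where $A^{1/2}B_d = \{A^{1/2}x : x \in B_d\}$, is a (possibly degenerate) ellipse in $E$ centered at the origin, of dimension $k \in \{0,1,2\}$. $C_E(A)$ is defined as the covariance matrix of the uniform distribution on $A^{1/2} B_d \cap E$, viewed as a $2\times 2$ matrix with respect to the basis $e_1, e_2$ of $E$. Here the uniform distribution on a convex set of dimension $k$ means normalized $k$-dimensional Lebesgue measure on the set in its linear span (the point mass at the origin if $k=0$). *)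

(* Defs.v *)
From HB Require Import structures.
From mathcomp Require Import all_boot all_order all_algebra.
From mathcomp Require Import all_classical all_reals all_analysis.
From mathcomp Require Import measurable_realfun.

Set Implicit Arguments.
Unset Strict Implicit.
Unset Printing Implicit Defensive.

Import Order.TTheory GRing.Theory Num.Theory.
Import numFieldNormedType.Exports.

Local Open Scope classical_set_scope.
Local Open Scope ring_scope.

(* Vectors of R^d are d.-tuple R: their library sigma-algebra is generated by
   the coordinates, i.e. it is the Borel sigma-algebra of R^d. *)

Definition mxact (R : realType) (d : nat) (M : 'M[R]_d) (x : d.-tuple R) :
  d.-tuple R := [tuple (M *m \col_j tnth x j) i 0 | i < d].

(* The norm `|_| of the library on vectors is the sup norm. *)
Definition euclidean_ball (R : realType) (d : nat) : set (d.-tuple R) :=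
  [set x | \sum_(i < d) tnth x i ^+ 2 <= 1].

Definition psd (R : realType) (d : nat) (A : 'M[R]_d) : Prop :=
  A^T = A /\ forall x : 'cV[R]_d, 0 <= (x^T *m A *m x) 0 0.

Definition psd_sqrt (R : realType) (d : nat) (A : 'M[R]_d) : 'M[R]_d :=
  xget 0 [set S : 'M[R]_d | psd S /\ S *m S = A].

(* The vector p.1 e_1 + p.2 e_2; this identifies E with R * R. *)
Definition plane_vec (R : realType) (d : nat) (p : R * R) : d.-tuple R :=
  [tuple if val i == 0%N then p.1 else if val i == 1%N then p.2 else 0
  | i < d].

(* A^{1/2} B_d `&` E, in the coordinates of E. *)
Definition ellipse (R : realType) (d : nat) (A : 'M[R]_d) : set (R * R) :=
  @plane_vec R d @^-1` (mxact (psd_sqrt A) @` @euclidean_ball R d).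

(* The restriction of mu to K, normalized. The point x0 only serves for the
   junk value [\d_x0], taken when K is not measurable or when mu K is 0 or
   +oo. *)
Definition uniform_law (R : realType) (dT : measure_display)
    (T : measurableType dT) (mu : {measure set T -> \bar R}) (K : set T)
    (x0 : T) : probability T R :=
  if pselect (measurable K) is left mK
  then mnormalize (mrestr mu mK) (dirac x0) else dirac x0.

(* lebesgue_measure is a measure on measurableTypeR R, i.e. R equipped with its
   Borel sigma-algebra. *)
Notation plane R := (measurableTypeR R * measurableTypeR R)%type.

Definition line (R : realType) (u : R * R) (t : measurableTypeR R) : plane R :=
  (t * u.1, t * u.2).

Lemma measurable_line (R : realType) (u : R * R) :
  measurable_fun [set: measurableTypeR R] (line u).
Proof.
by apply: measurable_fun_pair; exact: mulrr_measurable.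
Qed.

HB.instance Definition _ (R : realType) (u : R * R) :=
  isMeasurableFun.Build _ _ _ _ (line u) (@measurable_line R u).

Definition on_line (R : realType) (K : set (R * R)) (u : R * R) : Prop :=
  u.1 ^+ 2 + u.2 ^+ 2 = 1 /\ K `<=` range (line u).

Definition uniform_on_line (R : realType) (K : set (R * R)) (u : R * R) :
    probability (plane R) R :=
  distribution (uniform_law lebesgue_measure (line u @^-1` K) 0) (line u).

(* The uniform distribution on K, with respect to the k-dimensional Lebesgue
   measure, k being the dimension of the linear span of K: k = 0 if K is
   included in {0}; k = 1 if K is included in a line spanned by a unit vector u,
   whose Lebesgue measure is the image of that of R by the isometry
   t |-> t u; k = 2 otherwise. *)
Definition uniform_distribution (R : realType) (K : set (R * R)) :
    probability (plane R) R :=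
  if pselect (K `<=` [set (0, 0)]) is left _ then dirac ((0, 0) : plane R)
  else if pselect (exists u, on_line K u) is left ex_u
  then uniform_on_line K (sval (cid ex_u))
  else uniform_law (lebesgue_measure \x lebesgue_measure)%E K (0, 0).

Definition plane_coord (R : realType) (i : 'I_2) (p : R * R) : R :=
  if i == 0 then p.1 else p.2.

Definition covariance_matrix (R : realType)
    (mu : probability (plane R) R) : 'M[R]_2 :=
  \matrix_(i < 2, j < 2) fine (covariance mu (plane_coord i) (plane_coord j)).

Definition CE (R : realType) (d : nat) (A : 'M[R]_d) : 'M[R]_2 :=
  covariance_matrix (uniform_distribution (ellipse A)).

(* The law of X is N(0, Id), i.e. the d-fold product of N(0, 1). *)
Definition standard_gaussian (R : realType) (dT : measure_display)
    (T : measurableType dT) (P : probability T R) (d : nat)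
    (X : {RV P >-> d.-tuple R}) : Prop :=
  forall B : 'I_d -> set R, (forall i, measurable (B i)) ->
    distribution P X [set x | forall i, B i (tnth x i)] =
    (\prod_(i < d) normal_prob 0 1 (B i))%E.

Definition mutually_independent (R : realType) (dT dU : measure_display)
    (T : measurableType dT) (U : measurableType dU) (P : probability T R)
    (I : finType) (X : I -> {RV P >-> U}) : Prop :=
  forall (J : {set I}) (B : I -> set U), (forall i, measurable (B i)) ->
    P (\bigcap_(i in [set` J]) (X i @^-1` B i)) =
    (\prod_(i in J) P (X i @^-1` B i))%E.

(* Main.v *)
From HB Require Import structures.
Require Import Defs.
From mathcomp Require Import all_boot all_order all_algebra.
From mathcomp Require Import all_classical all_reals all_analysis.
From mathcomp Require Import measurable_realfun ring lra.

(* For slopes b in R^d supported on the coordinates 2, .., d - 1 and s >= 0, let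
   S be the symmetric matrix with
     (S x)_0 = s x_0 + sum_l b_l w_l,  (S x)_1 = 0,  (S x)_l = w_l  (l >= 2),
   where w_l = x_l + b_l x_0; it is V^T diag(s, 0, 1, .., 1) V for a transvection
   V, hence positive semi-definite, and it is the root of A = S^2.  If s = 0 then
   S B_d meets E only in 0 and the rank of C_E(A) is 0; if s > 0 it meets E in a
   segment and the rank is not 0.  Yet no statistic distinguishes s = 0 from a
   tiny s > 0 when the slopes are themselves random: given n <= d - 2 samples, the
   block W of the coordinates w_2, .., w_(n+1) is almost surely invertible, so that
   the noise s x_0 equals W k for a small vector k, and replacing b by b + k
   absorbs it.  The slopes b_l = c h_l are taken from Gaussians h_l, read off a
   second independent copy of the probability space, and c is so small that both
   the passage from x_l to w_l and the change of slopes are shifts of standard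
   Gaussian coordinates by small amounts.  On bounded sets such shifts multiply
   probabilities by a factor close to 1 at most. *)

Set Implicit Arguments.
Unset Strict Implicit.
Unset Printing Implicit Defensive.

Import Order.TTheory GRing.Theory Num.Theory.
Import numFieldNormedType.Exports.

Local Open Scope classical_set_scope.
Local Open Scope ring_scope.

(** * Shifts of Gaussian coordinates *)

Lemma lebesgue_measure_shift (R : realType) (c : R)
    (A : set (measurableTypeR R)) : measurable A ->
  lebesgue_measure ((fun t => t + c) @^-1` A) = lebesgue_measure A.
Proof.
move=> mA.
have mf : measurable_fun setT (fun t : measurableTypeR R => t + c).
  exact: measurable_funD.
apply/esym.
apply: (lebesgue_measure_unique (mu := pushforward lebesgue_measure (fun t :
  measurableTypeR R => (t + c : measurableTypeR R)))) => //.
move=> X [[a b]] _ <-; rewrite /pushforward/=.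
set B := (X in _ = lebesgue_measure X); have -> : B = `]a - c, b - c]%classic.
  by rewrite {}/B; apply/seteqP; split => x /=;
    rewrite !in_itv/= ltrBlDr lerBrDr.
rewrite !lebesgue_measure_itv/= !lte_fin ltrD2r; case: ifP => // _.
by rewrite -!EFinD; congr EFin; ring.
Qed.

(** After a change of variable both sides are integrals over [A]. The ratio of the two densities is
    [exp (x c - c^2 / 2)], which is at most [expR e] where [|x| |c| <= e]. *)
Lemma normal_shift (R : realType) (c e : R) (A : set (measurableTypeR R)) :
  measurable A -> (forall t, A t -> `|t| * `|c| <= e) ->
  (normal_prob 0 1 ((fun t => t + c)%R @^-1` A) <= (expR e)%:E * normal_prob 0
    1 A)%E.
Proof.
move=> mA Ac.
have mf : measurable_fun setT (fun t : measurableTypeR R => (t + c :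
  measurableTypeR R)).
  exact: measurable_funD.
have mpdf : measurable_fun setT (fun t : R => normal_pdf 0 1 (t - c)).
  apply: (measurableT_comp (measurable_normal_pdf 0 1)).
  exact: measurable_funB.
rewrite /normal_prob.
have -> : (\int[lebesgue_measure]_(x in (fun t : R => t + c)%R @^-1` A)
  (normal_pdf 0 1 x)%:E =
   \int[lebesgue_measure]_(x in A) (normal_pdf 0 1 (x - c))%:E)%E.
  transitivity (\int[pushforward lebesgue_measure (fun t : measurableTypeR R =>
    (t + c : measurableTypeR R)%R)]_(x in A) (normal_pdf 0 1 (x - c))%:E)%E.
    rewrite ge0_integral_pushforward//.
    - by apply: eq_integral => x _ /=; rewrite addrK.
    - by apply/measurable_EFinP; exact: measurable_funS mpdf.
    - by move=> x _; rewrite lee_fin normal_pdf_ge0.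
  apply: eq_measure_integral => B mB _.
  exact: lebesgue_measure_shift.
rewrite -ge0_integralZl_EFin ?expR_ge0//; first last.
- by apply/measurable_EFinP; apply: measurable_funS (measurable_normal_pdf 0 1).
- by move=> x _; rewrite lee_fin normal_pdf_ge0.
apply: ge0_le_integral => //.
- by move=> x _; rewrite lee_fin normal_pdf_ge0.
- by apply/measurable_EFinP; exact: measurable_funS mpdf.
- apply/measurable_EFinP; apply: measurable_funM => //.
  by apply: measurable_funS (measurable_normal_pdf 0 1).
- move=> x Ax; rewrite lee_fin !normal_pdfE ?oner_neq0//.
  rewrite mulrCA ler_wpM2l ?normal_peak_ge0// /normal_fun -expRD ler_expR.
  rewrite expr1n.
  have xc : x * c <= e.
    by rewrite (le_trans (ler_norm _))// normrM Ac.
  have c2 : 0 <= c ^+ 2 by exact: sqr_ge0.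
  have -> : - (x - c - 0) ^+ 2 / (1 *+ 2) = x * c - c ^+ 2 / 2 - x ^+ 2 / 2 by
    field.
  have -> : - (x - 0) ^+ 2 / (1 *+ 2) = - (x ^+ 2 / 2) by field.
  lra.
Qed.

(** * Gaussian samples in coordinates *)

Definition coord (R : realType) (n d : nat) (z : n.-tuple (d.-tuple R))
  (q : 'I_n * 'I_d) : R := tnth (tnth z q.1) q.2.

Definition of_coord (R : realType) (n d : nat) (f : 'I_n * 'I_d -> R) :
  n.-tuple (d.-tuple R) := [tuple [tuple f (i, l) | l < d] | i < n].

Lemma of_coordK (R : realType) (n d : nat) (f : 'I_n * 'I_d -> R) q :
  coord (of_coord f) q = f q.
Proof. by rewrite /coord !tnth_mktuple -surjective_pairing. Qed.

Lemma coord_inj (R : realType) (n d : nat) (y z : n.-tuple (d.-tuple R)) :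
  coord y =1 coord z -> y = z.
Proof.
move=> yz; apply: eq_from_tnth => i; apply: eq_from_tnth => l.
exact: (yz (i, l)).
Qed.

Lemma measurable_coord (R : realType) (n d : nat) (q : 'I_n * 'I_d) :
  measurable_fun setT (fun z : n.-tuple (d.-tuple R) => coord z q).
Proof.
apply: (measurableT_comp (measurable_tnth (T := R) q.2)).
exact: measurable_tnth.
Qed.

Lemma measurable_of_coord (R : realType) (n d : nat) (dT : measure_display)
    (T : measurableType dT) (f : T -> 'I_n * 'I_d -> R) :
  (forall q, measurable_fun setT (f ^~ q)) ->
  measurable_fun setT (fun w => of_coord (f w)).
Proof.
move=> mf; apply/measurable_fun_tnthP => i; apply/measurable_fun_tnthP => l.
apply: eq_measurable_fun (mf (i, l)) => w _ /=.
by rewrite -(of_coordK (f w)).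
Qed.

Definition rectangle (R : realType) (n d : nat)
    (B : 'I_n * 'I_d -> set R) : set (n.-tuple (d.-tuple R)) :=
  [set z | forall q, B q (coord z q)].

Lemma measurable_rectangle (R : realType) (n d : nat)
    (B : 'I_n * 'I_d -> set R) :
  (forall q, measurable (B q)) -> measurable (rectangle B).
Proof.
move=> mB.
have -> : rectangle B = \bigcap_(q in [set: 'I_n * 'I_d]) ((fun z => coord z q)
  @^-1` B q).
  apply/seteqP; split => z /= zB q; first by move=> _; exact: zB.
  exact: zB.
apply: fin_bigcap_measurable => // q _.
rewrite -[X in measurable X]setTI; exact: measurable_coord.
Qed.

(** The nontrivial inclusion says that the identity is measurable from the sigma-algebra generated
    by rectangles. It is enough to check coordinates, and a condition on a single coordinate is a
    rectangle whose other sides are full. *)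
Lemma rectangle_generates (R : realType) (n d : nat) :
  measurable = <<s [set rectangle B | B in
    [set B : 'I_n * 'I_d -> set R | forall q, measurable (B q)]] >>.
Proof.
set G := image _ _.
apply/seteqP; split; last first.
  apply: smallest_sub; first exact: sigma_algebra_measurable.
  by move=> _ [B mB <-]; exact: measurable_rectangle.
move=> A mA.
have mid : measurable_fun setT
    (id : g_sigma_algebraType G -> n.-tuple (d.-tuple R)).
  apply/measurable_fun_tnthP => i; apply/measurable_fun_tnthP => l.
  move=> _ C mC; rewrite setTI; apply: sub_sigma_algebra.
  exists (fun q => if q == (i, l) then C else setT).
    by move=> q; case: ifP.
  apply/seteqP; split => z /=.
    by move=> /(_ (i, l)); rewrite eqxx.
  by move=> zC q; case: eqVneq => [->|].
by have := mid measurableT A mA; rewrite setTI.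
Qed.

Lemma rectangle_unique (R : realType) (n d : nat)
    (mu nu : {finite_measure set (n.-tuple (d.-tuple R)) -> \bar R}) :
  (forall B : 'I_n * 'I_d -> set R, (forall q, measurable (B q)) ->
    mu (rectangle B) = nu (rectangle B)) ->
  forall A, measurable A -> mu A = nu A.
Proof.
move=> munu A mA.
apply: (measure_unique _ (fun=> setT) (rectangle_generates R n d)) => //.
- move=> _ _ [B mB <-] [C mC <-]; exists (fun q => B q `&` C q).
    by move=> q; exact: measurableI.
  apply/seteqP; split => z /=.
    by move=> zBC; split => q; have [] := zBC q.
  by move=> [zB zC] q; split.
- move=> _; exists (fun=> setT) => //.
  by apply/seteqP; split.
- by rewrite bigcup_const//; exists 0%N.
- by move=> _ [B mB <-]; exact: munu.
- by move=> _; rewrite ltey_eq fin_num_measure.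
Qed.

Definition gaussian_sample (R : realType) (n d : nat) (dT : measure_display)
    (T : measurableType dT) (P : probability T R)
    (Z : {RV P >-> n.-tuple (d.-tuple R)}) : Prop :=
  forall B : 'I_n * 'I_d -> set R, (forall q, measurable (B q)) ->
    P (Z @^-1` rectangle B) = (\prod_q normal_prob 0 1 (B q))%E.

Definition set_coord (R : realType) (n d : nat) (q : 'I_n * 'I_d)
    (z : n.-tuple (d.-tuple R)) (t : R) :=
  of_coord (fun q' => if q' == q then t else coord z q').

Lemma measurable_set_coord (R : realType) (n d : nat) (q : 'I_n * 'I_d) :
  measurable_fun setT (fun x : n.-tuple (d.-tuple R) * R => set_coord q x.1
    x.2).
Proof.
apply: measurable_of_coord => q'; case: eqVneq => _ /=;
  first exact: measurable_snd.
exact: (measurableT_comp (measurable_coord q') measurable_fst).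
Qed.

(** Redrawing one coordinate independently from N(0, 1) leaves the law unchanged, because both laws
    agree on rectangles. This is the tool for integrating one coordinate with the others frozen. *)
Lemma resample (R : realType) (n d : nat) (dT : measure_display)
    (T : measurableType dT) (P : probability T R)
    (Z : {RV P >-> n.-tuple (d.-tuple R)}) (q : 'I_n * 'I_d) A :
  gaussian_sample Z -> measurable A ->
  P (Z @^-1` A) =
  (\int[P]_w normal_prob 0 1 [set t | A (set_coord q (Z w) t)])%E.
Proof.
move=> gZ mA.
pose U (x : T * measurableTypeR R) := set_coord q (Z x.1) x.2.
have mU : measurable_fun setT U.
  have -> : U = (fun x => set_coord q x.1 x.2) \o (fun x => (Z x.1, x.2)) by [].
  apply: measurableT_comp; first exact: measurable_set_coord.
  apply: measurable_fun_pair => //.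
  exact: measurableT_comp.
pose mUm := isMeasurableFun.Build _ _ _ _ U mU.
pose Um : {mfun _ >-> _} := HB.pack U mUm.
pose N : probability _ R := normal_prob 0 1.
transitivity (distribution (P \x N)%E Um A); last first.
  rewrite /distribution/= /pushforward/= /product_measure1/=.
  by apply: eq_integral => w _; congr normal_prob; rewrite /xsection;
    apply/seteqP; split => t /=; rewrite inE.
rewrite -[LHS]/(distribution P Z A).
apply: (rectangle_unique _ mA) => B mB.
rewrite -[LHS]/(P (Z @^-1` rectangle B)) -[RHS]/((P \x N)%E (U @^-1` rectangle
  B)).
rewrite gZ//.
(* The old coordinate [q] is forgotten, whence the side [setT]; the new one carries the condition
   [B q]. *)
have -> : U @^-1` rectangle B = (Z @^-1` rectangle (fun q' => if q' == q then
  setT else B q')) `*` B q.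
  apply/seteqP; split => -[w t] /=.
    move=> UB; split.
      by move=> q'; have := UB q'; rewrite /U /set_coord of_coordK/=;
        case: eqVneq.
    by have := UB q; rewrite /U /set_coord of_coordK/= eqxx.
  move=> [ZB Bt] q'; have := ZB q'; rewrite /U /set_coord of_coordK/=.
  by case: eqVneq => [->|].
have mB' : forall q', measurable (if q' == q then setT else B q').
  by move=> q'; case: ifP.
transitivity (P (Z @^-1` rectangle (fun q' => if q' == q then setT else B q'))
  * N (B q))%E; last first.
  apply/esym/product_measure1E; last exact: mB.
  by apply: measurable_funPTI; exact: measurable_rectangle.
rewrite gZ// (bigD1 q)//= [in RHS](bigD1 q)//= eqxx.
rewrite [normal_prob 0 1 setT](_ : _ = 1%E) ?mul1e ?probability_setT//.
rewrite muleC; congr (_ * _)%E.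
by apply: eq_bigr => q' /negbTE ->.
Qed.

Definition shift_coord (R : realType) (n d : nat) (s : seq ('I_n * 'I_d))
    (D : 'I_n * 'I_d -> n.-tuple (d.-tuple R) -> R) (z : n.-tuple (d.-tuple R))
      :=
  of_coord (fun q => coord z q + if q \in s then D q z else 0).

Lemma measurable_shift_coord (R : realType) (n d : nat) (s : seq ('I_n * 'I_d))
    (D : 'I_n * 'I_d -> n.-tuple (d.-tuple R) -> R) :
  (forall q, measurable_fun setT (D q)) ->
  measurable_fun setT (shift_coord s D).
Proof.
move=> mD; apply: measurable_of_coord => q; apply: measurable_funD.
  exact: measurable_coord.
by case: (q \in s).
Qed.

Lemma measurable_set_coord_section (R : realType) (n d : nat) (q : 'I_n * 'I_d)
    (z : n.-tuple (d.-tuple R)) :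
  measurable_fun setT (fun t : measurableTypeR R => set_coord q z t).
Proof.
apply: measurable_of_coord => q'; case: eqVneq => _ /=;
  first exact: measurable_id.
exact: measurable_cst.
Qed.

Lemma measurable_resample (R : realType) (n d : nat) (dT : measure_display)
    (T : measurableType dT) (P : probability T R)
    (Z : {RV P >-> n.-tuple (d.-tuple R)}) (q : 'I_n * 'I_d) A :
  measurable A ->
  measurable [set x : T * measurableTypeR R | A (set_coord q (Z x.1) x.2)].
Proof.
move=> mA.
rewrite -[X in measurable X]setTI.
have mU : measurable_fun setT ((fun x => set_coord q x.1 x.2) \o
    (fun x : T * measurableTypeR R => (Z x.1, x.2))).
  apply: measurableT_comp; first exact: measurable_set_coord.
  apply: measurable_fun_pair => //.
  exact: measurableT_comp.
exact: (mU measurableT _ mA).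
Qed.

Lemma measurable_resample_prob (R : realType) (n d : nat) (dT : measure_display)
    (T : measurableType dT) (P : probability T R)
    (Z : {RV P >-> n.-tuple (d.-tuple R)}) (q : 'I_n * 'I_d) A :
  measurable A -> measurable_fun setT (fun w =>
    normal_prob 0 1 ([set t | A (set_coord q (Z w) t)] : set (measurableTypeR
      R))).
Proof.
move=> mA.
have := measurable_fun_xsection (normal_prob 0 1 : probability _ R)
  (measurable_resample Z q mA).
apply: eq_measurable_fun => w _ /=; congr normal_prob.
by rewrite /xsection; apply/seteqP; split => t /=; rewrite inE.
Qed.

(** Once [resample] freezes the other coordinates, [D] is a constant and [normal_shift] applies to
    each section of [A]. *)
Lemma gaussian_shift1 (R : realType) (n d : nat) (dT : measure_display)
    (T : measurableType dT) (P : probability T R)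
    (Z : {RV P >-> n.-tuple (d.-tuple R)}) (q : 'I_n * 'I_d)
    (D : n.-tuple (d.-tuple R) -> R) (e : R) A :
  gaussian_sample Z -> measurable A -> measurable_fun setT D ->
  (forall z t, D (set_coord q z t) = D z) ->
  (forall z, A z -> `|coord z q| * `|D z| <= e) ->
  (P (Z @^-1` [set z | A (set_coord q z (coord z q + D z)%R)]) <=
    (expR e)%:E * P (Z @^-1` A))%E.
Proof.
move=> gZ mA mD Dq De.
have mf : measurable_fun setT (fun z : n.-tuple (d.-tuple R) => set_coord q z
  (coord z q + D z)).
  have -> : (fun z : n.-tuple (d.-tuple R) => set_coord q z (coord z q + D z)) =
     (fun x => set_coord q x.1 x.2) \o (fun z => (z, coord z q + D z)) by [].
  apply: measurableT_comp; first exact: measurable_set_coord.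
  apply: measurable_fun_pair => //.
  by apply: measurable_funD => //; exact: measurable_coord.
have msec z : measurable ([set t | A (set_coord q z t)] : set (measurableTypeR
  R)).
  rewrite -[X in measurable X]setTI.
  exact: (measurable_set_coord_section q z measurableT mA).
have mN B (mB : measurable B) := measurable_resample_prob Z q mB.
rewrite (resample q gZ); last by rewrite -[X in measurable X]setTI;
  exact: (mf measurableT _ mA).
rewrite (resample q gZ mA) -ge0_integralZl_EFin ?expR_ge0//; last exact: mN.
apply: ge0_le_integral => //.
- by apply: (mN (fun z => A (set_coord q z (coord z q + D z))));
    rewrite -[X in measurable X]setTI; exact: (mf measurableT _ mA).
- by apply: measurable_funeM; exact: mN.
move=> w _; apply: le_trans (normal_shift (c := D (Z w)) (e := e) (msec (Z w))
  _).
  rewrite le_eqVlt; apply/orP; left; apply/eqP; congr normal_prob.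
  apply/seteqP; split => t /=; rewrite Dq of_coordK eqxx.
    by congr A; apply: coord_inj => q'; rewrite !of_coordK; case: eqVneq.
  by congr A; apply: coord_inj => q'; rewrite !of_coordK; case: eqVneq.
by move=> t /= /De; rewrite Dq of_coordK eqxx.
Qed.

(** The coordinates in [s] are shifted one at a time, each at the cost of a factor [expR e]. Every
    [D q] reads only coordinates outside [s], so a shift already made does not alter the remaining
    ones. *)
Lemma gaussian_shift (R : realType) (n d : nat) (dT : measure_display)
    (T : measurableType dT) (P : probability T R)
    (Z : {RV P >-> n.-tuple (d.-tuple R)}) (s : seq ('I_n * 'I_d))
    (D : 'I_n * 'I_d -> n.-tuple (d.-tuple R) -> R) (e : R) A :
  gaussian_sample Z -> uniq s -> measurable A ->
  (forall q, measurable_fun setT (D q)) ->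
  (forall q y z, {in predC (mem s), coord y =1 coord z} -> D q y = D q z) ->
  (forall z q, A z -> q \in s -> `|coord z q| * `|D q z| <= e) ->
  (P (Z @^-1` (shift_coord s D @^-1` A)) <=
    (expR (e *+ size s))%:E * P (Z @^-1` A))%E.
Proof.
move=> gZ + mA mD; elim: s => [_ _ _|q s IHs /= /andP[qs us] Ds De].
  rewrite mulr0n expR0 mul1e [shift_coord _ _ @^-1` A](_ : _ = A)//.
  have sz z : shift_coord [::] D z = z.
    by apply: coord_inj => q; rewrite of_coordK addr0.
  by apply/seteqP; split => z /=; rewrite sz.
have Ds' q' y z : {in predC (mem s), coord y =1 coord z} -> D q' y = D q' z.
  move=> yz; apply: Ds => p; rewrite !inE negb_or => /andP[_ ps].
  by apply: yz; rewrite inE.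
have DZ q' z : D q' (shift_coord s D z) = D q' z.
  apply: Ds' => p ps; have {}ps : p \notin s by [].
  by rewrite of_coordK (negbTE ps) addr0.
rewrite mulrS expRD EFinM -muleA.
apply: le_trans (_ : _ <= (expR e)%:E * P (Z @^-1` (shift_coord s D @^-1`
  A)))%E _; last first.
  rewrite lee_wpmul2l ?lee_fin ?expR_ge0//; apply: IHs => //.
  by move=> z q' Az q's; apply: De => //; rewrite inE q's orbT.
apply: le_trans (gaussian_shift1 (D := D q) (q := q)
  (A := shift_coord s D @^-1` A) gZ _ (mD q) _ _).
- rewrite le_eqVlt; apply/orP; left; apply/eqP; congr (P (Z @^-1` _)).
  have E z : shift_coord (q :: s) D z = shift_coord s D (set_coord q z (coord z
    q + D q z)).
    apply: coord_inj => p; rewrite !of_coordK inE; case: eqVneq => [->|pq] /=.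
      by rewrite (negbTE qs) addr0.
    congr (_ + _); case: ifP => // _; apply: Ds => p'.
    by rewrite !inE negb_or of_coordK => /andP[/negbTE -> _].
  by apply/seteqP; split => z /=; rewrite E.
- by rewrite -[X in measurable X]setTI; exact: (measurable_shift_coord s mD
    measurableT mA).
- by move=> z t; apply: Ds => p; rewrite !inE negb_or of_coordK =>
    /andP[/negbTE -> _].
- move=> z /= /De /(_ (mem_head _ _)).
  by rewrite DZ of_coordK (negbTE qs) addr0.
Qed.

(** * Almost sure invertibility of Gaussian minors *)

Lemma normal_prob_set1 (R : realType) (x : R) :
  normal_prob 0 1 ([set x] : set (measurableTypeR R)) = 0%E.
Proof.
have /null_content_dominatesP := @normal_prob_dominates R 0 1.
by apply => //; exact: lebesgue_measure_set1.
Qed.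

Lemma measurable_det (R : realType) (dT : measure_display)
    (T : measurableType dT) (m : nat) (A : T -> 'M[R]_m) :
  (forall i j, measurable_fun setT (fun w => A w i j)) ->
  measurable_fun setT (fun w => \det (A w)).
Proof.
move=> mA; rewrite /determinant; apply: measurable_sum => s.
by apply: measurable_funM => //; apply: measurable_prod => i _; exact: mA.
Qed.

Definition minor (R : realType) (n d m : nat) (f : 'I_m -> 'I_n)
  (g : 'I_m -> 'I_d) (z : n.-tuple (d.-tuple R)) : 'M[R]_m :=
  \matrix_(i, j) coord z (f i, g j).

Lemma measurable_det_minor (R : realType) (n d m : nat) (f : 'I_m -> 'I_n)
    (g : 'I_m -> 'I_d) :
  measurable_fun setT (fun z : n.-tuple (d.-tuple R) => \det (minor f g z)).
Proof.
apply: measurable_det => i j.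
by apply: eq_measurable_fun (measurable_coord (f i, g j)) => z _; rewrite mxE.
Qed.

(** Induction on [m]. The determinant is affine in its entry (0, 0), with the complementary minor as
    slope. Off the null event where that minor vanishes, a single value of the entry annihilates the
    determinant, and a Gaussian variable avoids it almost surely. *)
Lemma gaussian_minor_neq0 (R : realType) (n d : nat) (dT : measure_display)
    (T : measurableType dT) (P : probability T R)
    (Z : {RV P >-> n.-tuple (d.-tuple R)}) (m : nat) (f : 'I_m -> 'I_n)
    (g : 'I_m -> 'I_d) :
  gaussian_sample Z -> injective f -> injective g ->
  P (Z @^-1` [set z | \det (minor f g z) = 0]) = 0%E.
Proof.
move=> gZ; elim: m f g => [|m IHm] f g finj ginj.
  rewrite [X in P X](_ : _ = set0) ?measure0//.
  by apply/seteqP; split => // w /= /eqP; rewrite det_mx00 oner_eq0.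
have mdet0 k (f' : 'I_k -> 'I_n) (g' : 'I_k -> 'I_d) :
    measurable [set z : n.-tuple (d.-tuple R) | \det (minor f' g' z) = 0].
  have := @measurable_det_minor R n d k f' g' measurableT _ (measurable_set1 0).
  by rewrite setTI.
pose q := (f ord0, g ord0).
pose f' := f \o lift ord0; pose g' := g \o lift ord0.
have f'inj : injective f' by move=> i j /finj /lift_inj.
have g'inj : injective g' by move=> i j /ginj /lift_inj.
rewrite (resample q gZ)//; apply/eqP; rewrite eq_le integral_ge0 ?andbT//.
rewrite -(IHm f' g' f'inj g'inj).
set S := Z @^-1` _; have mS : measurable S by exact: measurable_funPTI.
rewrite (_ : P S = (\int[P]_w (\1_S w)%:E)%E);
  last by rewrite integral_indic// setIT.
apply: ge0_le_integral => //.
- exact: measurable_resample_prob.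
- apply/measurable_EFinP; exact: measurable_indic.
move=> w _; rewrite indicE; case: (boolP (w \in S)) => [_|].
  apply: probability_le1; rewrite -[X in measurable X]setTI.
  exact: (measurable_set_coord_section q (Z w) measurableT (mdet0 _ f g)).
rewrite notin_setE /= => /eqP det0.
(* The part of the expansion along row 0 that does not involve the resampled entry [q]. *)
pose c := \sum_(j < m) (minor f g (Z w)) ord0 (lift ord0 j) * cofactor (minor f
  g (Z w)) ord0 (lift ord0 j).
have cof z t j : cofactor (minor f g (set_coord q z t)) ord0 j = cofactor
  (minor f g z) ord0 j.
  rewrite /cofactor; congr (_ * \det _); apply/matrixP => a b;
    rewrite !mxE of_coordK.
  case: eqP => // -[/finj /eqP].
  by rewrite eq_sym (negbTE (neq_lift _ _)).
rewrite [leLHS](_ : _ = 0%E)//.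
apply: (@subset_measure0 _ _ _ (normal_prob 0 1) _ [set - c / \det (minor f' g'
  (Z w))]).
- rewrite -[X in measurable X]setTI.
  exact: (measurable_set_coord_section q (Z w) measurableT (mdet0 _ f g)).
- exact: measurable_set1.
- move=> t /= dt; have : t * \det (minor f' g' (Z w)) + c = 0.
    rewrite -[RHS]dt (expand_det_row _ ord0) big_ord_recl; congr (_ + _).
      rewrite cof mxE of_coordK eqxx /cofactor expr0 mul1r; congr (_ * \det _).
      by apply/matrixP => a b; rewrite !mxE.
    apply: eq_bigr => j _; rewrite cof; congr (_ * _).
    rewrite !mxE of_coordK; case: eqP => // -[/ginj /eqP].
    by rewrite eq_sym (negbTE (neq_lift _ _)).
  by move/eqP; rewrite addr_eq0 => /eqP <-; rewrite mulfK.
- exact: normal_prob_set1.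
Qed.

(** For integers [r] growing to infinity the events increase to the event [f w <> 0], of probability
    1, so continuity from below provides one of probability above [c]. With a determinant for [f],
    this keeps it away from 0 on a bounded region. *)
Lemma tightness (R : realType) (dT : measure_display) (T : measurableType dT)
    (P : probability T R) (f g : T -> R) (c : R) :
  measurable_fun setT f -> measurable_fun setT g ->
  P [set w | f w = 0] = 0%E -> c < 1 ->
  exists2 r : R, 0 <= r &
    (c%:E < P [set w | 1 <= r * `|f w| /\ g w <= r]%R)%E.
Proof.
move=> mf mg f0 c1.
pose F (m : nat) := [set w | 1 <= m%:R * `|f w| /\ g w <= m%:R].
have mF m : measurable (F m).
  have m1 : measurable_fun setT (fun w => 1 <= m%:R * `|f w|).
    apply: measurable_fun_ler => //; apply: measurable_funM => //.
    exact: measurableT_comp.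
  have m2 : measurable_fun setT (fun w => g w <= m%:R) by exact:
    measurable_fun_ler.
  rewrite (_ : F m = (fun w => (1 <= m%:R * `|f w|) && (g w <= m%:R)) @^-1`
    [set true]).
    by rewrite -[X in measurable X]setTI; apply: measurable_and => //.
  by apply/seteqP; split => w /=; [move=> [-> ->]|move=> /andP].
have ndF : nondecreasing_seq F.
  move=> m k mk; apply/subsetPset => w [fw gw]; split.
    by rewrite (le_trans fw)// ler_wpM2r// ler_nat.
  by rewrite (le_trans gw)// ler_nat.
have UF : \bigcup_m F m = ~` [set w | f w = 0].
  apply/seteqP; split => w /=.
    move=> [m _ [fw _]] fw0; move: fw; rewrite fw0 normr0 mulr0.
    by rewrite ler10.
  move=> /eqP fw0.
  (* An integer above both [1 / |f w|] and [g w]. *)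
  exists (maxn (Num.trunc `|f w|^-1).+1 (Num.trunc (g w)).+1) => //; split.
    rewrite -ler_pdivrMr ?normr_gt0// mul1r.
    apply: le_trans (ltW (truncnS_gt _)) _.
    by rewrite ler_nat leq_maxl.
  apply: le_trans (ltW (truncnS_gt _)) _.
  by rewrite ler_nat leq_maxr.
have mf0 : measurable [set w | f w = 0].
  by have := mf measurableT _ (measurable_set1 0); rewrite setTI.
have mU : measurable (\bigcup_m F m) by exact: bigcup_measurable.
have PU : P (\bigcup_m F m) = 1%E by rewrite UF probability_setC// f0 sube0.
have cvgF : P (F m) @[m --> \oo] --> 1%E.
  by rewrite -PU; exact: nondecreasing_cvg_mu.
apply: contrapT => noR.
have : (1 <= c%:E :> \bar R)%E.
  rewrite -(cvg_lim _ cvgF)//; apply: lime_le; first by apply/cvg_ex;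
    exists 1%E.
  near=> m; rewrite leNgt; apply/negP => cm; apply: noR.
  by exists m%:R.
by rewrite lee_fin leNgt c1.
Unshelve. all: by end_near.
Qed.

Lemma section_probability_swap (R : realType) (d1 d2 : measure_display)
    (T1 : measurableType d1) (T2 : measurableType d2)
    (P1 : probability T1 R) (P2 : probability T2 R) (A : set (T1 * T2)) :
  measurable A ->
  (\int[P1]_x P2 [set y | A (x, y)] = \int[P2]_y P1 [set x | A (x, y)])%E.
Proof.
move=> mA.
have sx x : xsection A x = [set y | A (x, y)].
  by rewrite /xsection; apply/seteqP; split => y /=; rewrite inE.
have sy y : ysection A y = [set x | A (x, y)].
  by rewrite /ysection; apply/seteqP; split => x /=; rewrite inE.
have := indic_fubini_tonelli P1 P2 mA.
rewrite indic_fubini_tonelli_FE// indic_fubini_tonelli_GE// => H.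
under eq_integral do rewrite -sx.
under [RHS]eq_integral do rewrite -sy.
exact: H.
Qed.

(** * Absorbing the noise into the slopes *)

Definition tail_coords (n p : nat) : seq ('I_n * 'I_p.+2) :=
  enum [pred q : 'I_n * 'I_p.+2 | (1 < q.2)%N].

Definition shear (R : realType) (n p : nat) (b : 'I_p.+2 -> R) :
    n.-tuple (p.+2.-tuple R) -> n.-tuple (p.+2.-tuple R) :=
  shift_coord (tail_coords n p) (fun q z => b q.2 * coord z (q.1, ord0)).

(** Here [z] stands for the sheared sample, with coordinates [w_l]: the vectors [A^{1/2} X_i] form
    [obs s b (shear b z)], see [mxact_model_root]. Factoring out the shear isolates what is a mere
    shift of Gaussian coordinates. *)
Definition obs (R : realType) (n p : nat) (s : R) (b : 'I_p.+2 -> R)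
    (z : n.-tuple (p.+2.-tuple R)) : n.-tuple (p.+2.-tuple R) :=
  of_coord (fun q =>
    if val q.2 == 0%N then s * coord z q + \sum_l b l * coord z (q.1, l)
    else if val q.2 == 1%N then 0 else coord z q).

Lemma measurable_obs (R : realType) (n p : nat) (s : R) (b : 'I_p.+2 -> R) :
  measurable_fun setT (obs s b : n.-tuple (p.+2.-tuple R) -> _).
Proof.
apply: measurable_of_coord => q; case: (val q.2 == 0%N).
  apply: measurable_funD; first by apply: measurable_funM => //;
    exact: measurable_coord.
  by apply: measurable_sum => l; apply: measurable_funM => //;
    exact: measurable_coord.
case: (val q.2 == 1%N) => //; exact: measurable_coord.
Qed.

Lemma shearE (R : realType) (n p : nat) (b : 'I_p.+2 -> R)
    (z : n.-tuple (p.+2.-tuple R)) q :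
  coord (shear b z) q =
  coord z q + if (1 < q.2)%N then b q.2 * coord z (q.1, ord0) else 0.
Proof. by rewrite of_coordK mem_enum. Qed.

Lemma measurable_shear_coord (R : realType) (n p : nat) (b : 'I_p.+2 -> R) q :
  measurable_fun setT (fun z : n.-tuple (p.+2.-tuple R) => b q.2 * coord z
    (q.1, ord0)).
Proof. by apply: measurable_funM => //; exact: measurable_coord. Qed.

Lemma measurable_shear (R : realType) (n p : nat) (b : 'I_p.+2 -> R) :
  measurable_fun setT (shear b : n.-tuple (p.+2.-tuple R) -> _).
Proof.
by apply: measurable_shift_coord => q; exact: measurable_shear_coord.
Qed.

Lemma shear_opp (R : realType) (n p : nat) (b : 'I_p.+2 -> R)
    (z : n.-tuple (p.+2.-tuple R)) : shear b (shear (\- b) z) = z.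
Proof.
apply: coord_inj => -[i l]; rewrite !shearE /=; case: ifP => _;
  last by rewrite !addr0.
by rewrite addr0 mulNr addrNK.
Qed.

Section shear_gaussian.
Context (R : realType) (n p : nat) (dT : measure_display)
  (T : measurableType dT) (P : probability T R)
  (Z : {RV P >-> n.-tuple (p.+2.-tuple R)}).
Context (gZ : gaussian_sample Z).
Let N := size (tail_coords n p).

(** The shift [b_l x_0] of a coordinate [l >= 2] reads only the coordinate 0, which is not shifted,
    so [gaussian_shift] applies. *)
Lemma shear_probability_le (b : 'I_p.+2 -> R) (e : R)
    (A : set (n.-tuple (p.+2.-tuple R))) :
  measurable A ->
  (forall z (q : 'I_n * 'I_p.+2), A z -> (1 < q.2)%N -> `|coord z q| * `|b q.2
    * coord z (q.1, ord0)| <= e) ->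
  (P (Z @^-1` (shear b @^-1` A)) <= (expR (e *+ N))%:E * P (Z @^-1` A))%E.
Proof.
move=> mA Ae; apply: gaussian_shift => //.
- exact: enum_uniq.
- by move=> q; exact: measurable_shear_coord.
- by move=> q y z yz; rewrite yz// !inE /= mem_enum.
- by move=> z q Az; rewrite mem_enum => q1; exact: Ae.
Qed.

(** This is the preceding bound for the inverse shear and the preimage of [A]. That preimage lies in
    the box of radius [r + 1], since the shear moves each coordinate by at most [|b l| r <= 1]. *)
Lemma probability_le_shear (b : 'I_p.+2 -> R) (e r : R)
    (A : set (n.-tuple (p.+2.-tuple R))) :
  measurable A -> 0 <= r -> (forall z q, A z -> `|coord z q| <= r) ->
  (forall l, `|b l| * r <= 1) -> (forall l, (r + 1) * (`|b l| * r) <= e) ->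
  (P (Z @^-1` A) <= (expR (e *+ N))%:E * P (Z @^-1` (shear b @^-1` A)))%E.
Proof.
move=> mA r0 Ar br1 bre.
have -> : A = shear (\- b) @^-1` (shear b @^-1` A).
  by apply/seteqP; split => z /=; rewrite shear_opp.
rewrite [X in (_ <= _ * P (_ @^-1` (_ @^-1` X)))%E](_ : _ = A); last first.
  by apply/seteqP; split => z /=; rewrite shear_opp.
apply: shear_probability_le.
  by rewrite -[X in measurable X]setTI; exact: (measurable_shear b measurableT
    mA).
move=> z [i l] /= Az l1; apply: le_trans (bre l).
have z0 : `|coord z (i, ord0)| <= r.
  by have := Ar _ (i, ord0) Az; rewrite shearE/= addr0.
have bz : `|b l * coord z (i, ord0)| <= `|b l| * r by rewrite normrM ler_wpM2l.
apply: ler_pM => //; last by rewrite mulNr normrN.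
have := Ar _ (i, l) Az; rewrite shearE/= l1 => zl.
rewrite -[coord z (i, l)](addrK (b l * coord z (i, ord0))).
by rewrite (le_trans (ler_normB _ _))// lerD// (le_trans bz).
Qed.

End shear_gaussian.

(** The Gaussians [h_l] are the coordinates of the sample [i0] of the second copy [y]. *)
Definition slope (R : realType) (n p : nat) (c : R) (i0 : 'I_n)
    (y : n.-tuple (p.+2.-tuple R)) (l : 'I_p.+2) : R :=
  if (1 < l)%N then c * coord y (i0, l) else 0.

Lemma measurable_obs_slope (R : realType) (n p : nat) (s c : R) (i0 : 'I_n) :
  measurable_fun setT
    (fun x : n.-tuple (p.+2.-tuple R) * n.-tuple (p.+2.-tuple R) =>
       obs s (slope c i0 x.1) x.2).
Proof.
have m2 q : measurable_fun setT
    (fun x : n.-tuple (p.+2.-tuple R) * n.-tuple (p.+2.-tuple R) => coord x.2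
      q).
  exact: (measurableT_comp (measurable_coord q) measurable_snd).
have m1 q : measurable_fun setT
    (fun x : n.-tuple (p.+2.-tuple R) * n.-tuple (p.+2.-tuple R) => coord x.1
      q).
  exact: (measurableT_comp (measurable_coord q) measurable_fst).
apply: measurable_of_coord => q; case: (val q.2 == 0%N).
  apply: measurable_funD; first by apply: measurable_funM.
  apply: measurable_sum => l; apply: measurable_funM => //.
  by rewrite /slope; case: (1 < l)%N => //; apply: measurable_funM.
by case: (val q.2 == 1%N).
Qed.

(* On the event where the samples of the coordinates [2, .., n + 1] form an
   invertible matrix [W], the noise [s * x] in the coordinate 0 equals [W k]:
   it is absorbed by a small change of the slopes. *)
Lemma obs_absorb (R : realType) (n p : nat) (s c : R) (i0 : 'I_n)
    (col : 'I_n -> 'I_p.+2) (y z : n.-tuple (p.+2.-tuple R)) (k : 'cV[R]_n) :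
  c != 0 -> (forall j, (1 < col j)%N) ->
  minor id col z *m k = \col_i coord z (i, ord0) ->
  obs s (slope c i0 y) z =
  obs 0 (slope c i0 (shift_coord (tail_coords n p)
    (fun q _ => s / c * \sum_j (k j 0 *+ (col j == q.2))) y)) z.
Proof.
move=> c0 col1 Wk; apply: coord_inj => -[i l]; rewrite !of_coordK /=.
case: eqVneq => // l0; rewrite mul0r add0r.
have {l0} l0 : l = ord0 by exact: val_inj.
rewrite {l}l0.
have -> : coord z (i, ord0) = \sum_j coord z (i, col j) * k j 0.
  transitivity ((minor id col z *m k) i 0); first by rewrite Wk mxE.
  by rewrite mxE; apply: eq_bigr => j _; rewrite mxE.
(* The change of the slopes: [s k_j] at the coordinate [col j]. Slopes being [c] times coordinates
   of [y], it amounts to shifting [y] by [a / c]. *)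
pose a l := s * \sum_j (k j 0 *+ (col j == l)).
have aE l : slope c i0 (shift_coord (tail_coords n p)
    (fun q _ => s / c * \sum_j (k j 0 *+ (col j == q.2))) y) l =
    slope c i0 y l + a l.
  rewrite /slope; case: ifPn => [l1|l1].
    by rewrite of_coordK mem_enum inE /= l1 /a; field.
  rewrite add0r /a big1 ?mulr0// => j _; case: eqP => // jl.
  by move: l1; rewrite -jl col1.
under [in RHS]eq_bigr do rewrite aE mulrDl.
rewrite big_split/= addrC; congr (_ + _).
rewrite /a; under [in RHS]eq_bigr do rewrite -mulrA mulr_suml.
rewrite -mulr_sumr exchange_big/=; congr (_ * _); apply: eq_bigr => j _.
rewrite (bigD1 (col j))//= eqxx mulr1n big1 ?addr0; first by rewrite mulrC.
by move=> l' /negbTE; rewrite eq_sym => ->; rewrite mul0r.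
Qed.

Lemma measurable_section_r (d1 d2 : measure_display) (T1 : measurableType d1)
    (T2 : measurableType d2) (A : set (T1 * T2)) y :
  measurable A -> measurable [set x | A (x, y)].
Proof.
move=> mA; rewrite (_ : [set x | _] = ysection A y);
  first exact: measurable_ysection.
by rewrite /ysection; apply/seteqP; split => x /=; rewrite inE.
Qed.

Lemma measurable_section_l (d1 d2 : measure_display) (T1 : measurableType d1)
    (T2 : measurableType d2) (A : set (T1 * T2)) x :
  measurable A -> measurable [set y | A (x, y)].
Proof.
move=> mA; rewrite (_ : [set y | _] = xsection A x);
  first exact: measurable_xsection.
by rewrite /xsection; apply/seteqP; split => y /=; rewrite inE.
Qed.

Lemma measurable_probability_section (R : realType) (d1 d2 : measure_display)
    (T1 : measurableType d1) (T2 : measurableType d2) (P : probability T2 R)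
    (A : set (T1 * T2)) :
  measurable A -> measurable_fun setT (fun x => P [set y | A (x, y)]).
Proof.
move=> mA; apply: eq_measurable_fun (measurable_fun_xsection P mA) => x _ /=.
by congr (P _); rewrite /xsection; apply/seteqP; split => y /=; rewrite inE.
Qed.

Lemma measurable_probability_section_r (R : realType) (d1 d2 : measure_display)
    (T1 : measurableType d1) (T2 : measurableType d2) (P : probability T1 R)
    (A : set (T1 * T2)) :
  measurable A -> measurable_fun setT (fun y => P [set x | A (x, y)]).
Proof.
move=> mA; apply: eq_measurable_fun (measurable_fun_ysection P mA) => y _ /=.
by congr (P _); rewrite /ysection; apply/seteqP; split => x /=; rewrite inE.
Qed.

Lemma expR_mulrn_bound (R : realType) (N : nat) (C : R) :
  1 < C -> exists2 e : R, 0 < e & expR (e *+ N) <= C.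
Proof.
(* Dividing by [N + 1] keeps [e] positive when [N = 0]. *)
move=> C1; exists (ln C / N.+1%:R).
  by rewrite divr_gt0// ln_gt0.
rewrite -[leRHS]lnK ?posrE ?(lt_trans _ C1)// ler_expR -[leLHS]mulr_natr -mulrA
  ler_piMr//.
  by rewrite ltW// ln_gt0.
by rewrite mulrC ler_pdivrMr// mul1r ler_nat.
Qed.

Lemma probability_setI_ge (R : realType) (dT : measure_display)
    (T : measurableType dT) (P : probability T R) (A B : set T) :
  measurable A -> measurable B -> (P A + P B <= 1 + P (A `&` B))%E.
Proof.
move=> mA mB; rewrite (measureDI P mA mB) addeAC leeD2r// -measureU//.
- by apply: probability_le1; apply: measurableU => //; exact: measurableD.
- exact: measurableD.
- by rewrite setDE -setIA setICl setI0.
Qed.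

(** * Comparison of the models with and without noise *)

Section indistinguishability.
Context (R : realType) (n p : nat) (dT : measure_display)
  (T : measurableType dT) (P : probability T R)
  (Z : {RV P >-> n.-tuple (p.+2.-tuple R)}).
Context (gZ : gaussian_sample Z).
Let sample := n.-tuple (p.+2.-tuple R).
Context (E : set sample) (mE : measurable E) (i0 : 'I_n).
Let N := size (tail_coords n p).
Let box (r : R) : set sample := [set y | forall q, `|coord y q| <= r].

Lemma measurable_box r : measurable (box r).
Proof.
have := @measurable_rectangle R n p.+2 (fun=> `[- r, r]%classic).
rewrite (_ : rectangle _ = box r); first by apply => q; exact: measurable_itv.
by apply/seteqP; split => y yr q; have := yr q; rewrite /= in_itv/= -ler_norml.
Qed.

Let seen (s c : R) : set (sample * sample) :=
  [set x | E (obs s (slope c i0 x.1) x.2)].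

Lemma measurable_seen s c : measurable (seen s c).
Proof.
rewrite -[X in measurable X]setTI.
exact: (@measurable_obs_slope R n p s c i0 measurableT _ mE).
Qed.

Lemma slope_le c r y l : 0 <= c -> 0 <= r -> box r y -> `|slope c i0 y l| <= c
  * r.
Proof.
move=> c0 r0 yr; rewrite /slope; case: ifP => _;
  last by rewrite normr0 mulr_ge0.
by rewrite normrM ger0_norm// ler_wpM2l.
Qed.

(** The hypothesis concerns the sheared sample, the conclusion a sample whose [w_l] are themselves
    standard Gaussians. Shearing [G] costs a factor 11/10 and leaves it a probability above 0.86;
    its intersection with the event then has probability above 0.76, and undoing the shear costs a
    second factor 11/10, leaving more than 0.69. *)
Lemma observed_ge (s c r e C : R) (G : set sample) y :
  measurable G -> G `<=` box r -> 0 <= r -> 0 <= c ->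
  c * r * r <= 1 -> (r + 1) * (c * r * r) <= e -> expR (e *+ N) <= C -> C =
    11/10 ->
  ((95/100)%:E < P (Z @^-1` G))%E -> box r y ->
  ((9/10)%:E < P (Z @^-1` [set z | seen s c (y, shear (slope c i0 y) z)]))%E ->
  ((1/2)%:E <= P (Z @^-1` [set z | seen s c (y, z) /\ G z]))%E.
Proof.
move=> mG Gr r0 c0 cr1 cre eC CE PG yr PE.
pose b := slope c i0 y.
have br l : `|b l| * r <= c * r * r by rewrite ler_wpM2r// slope_le.
have mA : measurable [set z | seen s c (y, z)].
  exact: measurable_section_l (measurable_seen s c).
have mZ (A : set sample) : measurable A -> measurable (Z @^-1` A).
  by move=> mA'; exact: measurable_funPTI.
have mS (A : set sample) : measurable A -> measurable (shear b @^-1` A).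
  by move=> mA'; rewrite -[X in measurable X]setTI;
    exact: (measurable_shear b measurableT mA').
have mAG : measurable [set z | seen s c (y, z) /\ G z] by exact: measurableI.
have leC (x : \bar R) : (0 <= x)%E -> ((expR (e *+ N))%:E * x <= C%:E * x)%E.
  by move=> x0; rewrite lee_wpmul2r// lee_fin.
have H1 : (P (Z @^-1` G) <= C%:E * P (Z @^-1` (shear b @^-1` G)))%E.
  apply: le_trans (leC _ (measure_ge0 _ _)).
  apply: (probability_le_shear gZ (r := r)) => //.
  - by move=> z q Gz; exact: Gr.
  - by move=> l; exact: le_trans (br l) cr1.
  - by move=> l; apply: le_trans cre; rewrite ler_wpM2l// addr_ge0.
have H2 : (P (Z @^-1` (shear b @^-1` [set z | seen s c (y, z) /\ G z])) <=
    C%:E * P (Z @^-1` [set z | seen s c (y, z) /\ G z]))%E.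
  apply: le_trans (leC _ (measure_ge0 _ _)).
  apply: (shear_probability_le gZ) => // z [i l] [_ Gz] _ /=.
  apply: le_trans cre; apply: ler_pM => //.
    by rewrite (le_trans (Gr _ Gz _))// lerDl.
  rewrite normrM; apply: le_trans (br l); rewrite ler_wpM2l//; exact: (Gr _ Gz).
set A1 := [set z | seen s c (y, shear (slope c i0 y) z)] in PE.
set A2 := shear b @^-1` G in H1.
have H3 : (P (Z @^-1` A1) + P (Z @^-1` A2) <= 1 + P (Z @^-1` (A1 `&` A2)))%E.
  have mA1 := mZ _ (mS _ mA); have mA2 := mZ _ (mS _ mG).
  exact: probability_setI_ge.
rewrite -[shear b @^-1` _]/(A1 `&` A2) in H2.
move: PG PE H1 H2 H3.
have fin A : measurable A -> P A \is a fin_num by move=> mX;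
  exact: fin_num_measure.
rewrite -(fineK (fin _ (mZ _ mG))) -(fineK (fin _ (mZ _ (mS _ mA)))).
rewrite -(fineK (fin _ (mZ _ (mS _ mG)))) -(fineK (fin _ (mZ _ (mS _ mAG)))).
rewrite -(fineK (fin _ (mZ _ mAG))).
rewrite -!EFinM -!EFinD !lee_fin !lte_fin CE.
lra.
Qed.

(** A single transfer by the shear suffices: 11/10 times 1/10 is below 1/5. The box for [y] has
    radius [r + 1] because the change of slopes will have shifted [y]. *)
Lemma observed_le (c r e C : R) (G : set sample) y :
  measurable G -> G `<=` box r -> 0 <= r -> 0 <= c ->
  c * (r + 1) * r <= 1 -> (r + 1) * (c * (r + 1) * r) <= e ->
  expR (e *+ N) <= C -> C = 11/10 -> box (r + 1) y ->
  (P (Z @^-1` [set z | seen 0 c (y, shear (slope c i0 y) z)]) <= (1/10)%:E)%E ->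
  (P (Z @^-1` [set z | seen 0 c (y, z) /\ G z]) <= (1/5)%:E)%E.
Proof.
move=> mG Gr r0 c0 cr1 cre eC CE yr PE.
have r10 : 0 <= r + 1 by rewrite addr_ge0.
pose b := slope c i0 y.
have br l : `|b l| * r <= c * (r + 1) * r by rewrite ler_wpM2r// slope_le.
have mA : measurable [set z | seen 0 c (y, z)].
  exact: measurable_section_l (measurable_seen 0 c).
have mS (A : set sample) : measurable A -> measurable (shear b @^-1` A).
  by move=> mA'; rewrite -[X in measurable X]setTI;
    exact: (measurable_shear b measurableT mA').
have mAG : measurable [set z | seen 0 c (y, z) /\ G z] by exact: measurableI.
apply: (le_trans (probability_le_shear gZ (b := b) (e := e) (r := r) mAG r0 _ _
  _)).
- by move=> z q [_ Gz]; exact: (Gr _ Gz).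
- by move=> l; exact: le_trans (br l) cr1.
- by move=> l; apply: le_trans cre; rewrite ler_wpM2l.
have PE' : (P (Z @^-1` (shear b @^-1` [set z | seen 0 c (y, z) /\ G z])) <=
  (1/10)%:E)%E.
  apply: le_trans PE; apply: le_measure; rewrite ?inE.
  - exact: measurable_funPTI (mS _ mAG).
  - exact: measurable_funPTI (mS _ mA).
  - by move=> w [].
apply: (@le_trans _ _ (C%:E * (1/10)%:E)%E).
  by apply: lee_pmul => //; rewrite lee_fin// expR_ge0.
by rewrite -EFinM lee_fin CE; lra.
Qed.

End indistinguishability.

(** On the product of two copies of the space, [u] yields the slopes and [w] the samples. [L1] is a
    lower bound with noise, [L3] an upper bound without noise, and [L2] compares the two up to a
    factor 11/10, by integrating over [u] first. *)
Lemma indistinguishable (R : realType) (n p : nat) (dT : measure_display)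
    (T : measurableType dT) (P : probability T R)
    (Z : {RV P >-> n.-tuple (p.+2.-tuple R)}) (E : set (n.-tuple (p.+2.-tuple
      R))) :
  gaussian_sample Z -> (0 < n <= p)%N -> measurable E ->
  (forall s b, 0 < s -> (forall l : 'I_p.+2, (l <= 1)%N -> b l = 0) ->
    ((9/10)%:E < P (Z @^-1` [set z | E (obs s b (shear b z))]))%E) ->
  (forall b, (forall l : 'I_p.+2, (l <= 1)%N -> b l = 0) ->
    (P (Z @^-1` [set z | E (obs 0 b (shear b z))]) <= (1/10)%:E)%E) ->
  False.
Proof.
move=> gZ /andP[n0 np] mE Efull Esing.
pose i0 := Ordinal n0.
(* Since [n <= p], the coordinates [2, .., n + 1] exist and supply the columns of the square matrix
   [W]. *)
pose col (j : 'I_n) : 'I_p.+2 := rshift 2 (widen_ord np j).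
have col1 j : (1 < col j)%N by [].
have colinj : injective col by move=> i j /(congr1 val) /= /addnI ij;
  exact: val_inj.
pose x (z : n.-tuple (p.+2.-tuple R)) : 'cV[R]_n := \col_i coord z (i, ord0).
pose W (z : n.-tuple (p.+2.-tuple R)) := minor id col z.
(* By Cramer's rule the solution [k] of [W k = x] is [a z / \det (W z)]. On the event [G] below, the
   sum of the [|k_j|] is therefore at most [r^2]. *)
pose a z := \adj (W z) *m x z.
pose phi z := \sum_q `|coord z q| + \sum_j `|a z j 0|.
have mW : measurable_fun setT (fun z => \det (W z)) by exact:
  measurable_det_minor.
have mphi : measurable_fun setT phi.
  apply: measurable_funD; apply: measurable_sum => q.
    by apply: measurableT_comp => //; exact: measurable_coord.
  apply: measurableT_comp => //; rewrite /a.
  under eq_fun do rewrite mxE; apply: measurable_sum => j.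
  under eq_fun do rewrite !mxE; apply: measurable_funM;
    last exact: measurable_coord.
  rewrite /cofactor; apply: measurable_funM => //; apply: measurable_det => u v.
  under eq_fun do rewrite !mxE; exact: measurable_coord.
have [r r0 Pr] : exists2 r : R, 0 <= r & ((95/100)%:E < P [set w |
    1 <= r * `|\det (W (Z w))| /\ phi (Z w) <= r]%R)%E.
  apply: tightness; last by lra.
  - exact: (measurableT_comp mW).
  - exact: (measurableT_comp mphi).
  - by apply: gaussian_minor_neq0 => //.
pose G := [set z | 1 <= r * `|\det (W z)| /\ phi z <= r].
have mG : measurable G.
  have m1 : measurable_fun setT (fun w => 1 <= r * `|\det (W w)|).
    apply: measurable_fun_ler => //; apply: measurable_funM => //.
    exact: measurableT_comp.
  have m2 : measurable_fun setT (fun w => phi w <= r) by exact: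
    measurable_fun_ler.
  rewrite (_ : G = (fun w => (1 <= r * `|\det (W w)|) && (phi w <= r)) @^-1`
    [set true]).
    by rewrite -[X in measurable X]setTI; apply: measurable_and => //.
  by apply/seteqP; split => w /=; [move=> [-> ->]|move=> /andP].
pose box (r : R) := [set y : n.-tuple (p.+2.-tuple R) | forall q, `|coord y q|
  <= r].
have Gbox : G `<=` box r.
  move=> z [_ zr] q; apply: le_trans zr; rewrite /phi (bigD1 q)//= -addrA lerDl.
  by rewrite addr_ge0// sumr_ge0.
pose N := size (tail_coords n p).
have [e e0 eC] := @expR_mulrn_bound R N (11/10) ltac:(lra).
pose m := Num.min 1 e.
have m0 : 0 < m by rewrite lt_min ltr01.
have m1 : m <= 1 by rewrite ge_min lexx.
have me : m <= e by rewrite ge_min lexx orbT.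
(* [c] makes the shears, and [s] the changes of slopes, shifts of size at most
   [m / (r + 1)] on the box of radius [r + 1]. *)
pose c := m / (r + 1) ^+ 3.
have r1 : 0 < r + 1 by rewrite ltr_wpDl.
have c0 : 0 < c by rewrite divr_gt0// exprn_gt0.
have cm : c * (r + 1) ^+ 3 = m by rewrite divfK// gt_eqF// exprn_gt0.
pose s := c * (m / (r + 1) ^+ 3).
have s0 : 0 < s by rewrite mulr_gt0// divr_gt0// exprn_gt0.
have scE : s / c = c by rewrite /s mulrAC divff ?mul1r// gt_eqF.
(* [H1] and [H2] control the shears, whose slopes are at most [c (r + 1)]; [H3] and [H4] control the
   shift of the slope variables, at most [(s / c) r^2 = c r^2]. *)
have H1 : c * (r + 1) * r <= m by rewrite -cm; nra.
have H2 : (r + 1) * (c * (r + 1) * r) <= m by rewrite -cm; nra.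
have H3 : c * r ^+ 2 <= m by rewrite -cm; nra.
have H4 : (r + 1) * (c * r ^+ 2) <= m by rewrite -cm; nra.
(* The radius [ro] is [r] with noise and [r + 1] without: absorbing the noise moves the slope
   variables by at most 1. *)
pose Q s ro : set (T * T) := [set w | box ro (Z w.1) /\
  (E (obs s (slope c i0 (Z w.1)) (Z w.2)) /\ G (Z w.2))].
have mbox ro : measurable (box ro) by exact: measurable_box.
have mseen s' : measurable [set x : _ * _ | E (obs s' (slope c i0 x.1) x.2)].
  exact: measurable_seen.
have mQ s' ro : measurable (Q s' ro).
  have mZ1 : measurable_fun setT (fun w : T * T => Z w.1) by exact:
    measurableT_comp.
  have mZ2 : measurable_fun setT (fun w : T * T => Z w.2) by exact:
    measurableT_comp.
  have mZZ : measurable_fun setT (fun w : T * T => (Z w.1, Z w.2)).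
    exact: measurable_fun_pair.
  apply: measurableI.
    by rewrite -[X in measurable X]setTI; exact: (mZ1 measurableT _ (mbox ro)).
  apply: measurableI.
    by rewrite -[X in measurable X]setTI; exact: (mZZ measurableT _ (mseen s')).
  by rewrite -[X in measurable X]setTI; exact: (mZ2 measurableT _ mG).
have P0 A : (0 <= P A)%E by exact: measure_ge0.
have L1 : ((1/2)%:E * (95/100)%:E <= \int[P]_u P [set w | Q s r (u, w)])%E.
  pose S := Z @^-1` box r.
  have mS : measurable S by exact: measurable_funPTI.
  apply: (@le_trans _ _ (\int[P]_u ((1/2)%:E * (\1_S u)%:E))%E).
    rewrite ge0_integralZl_EFin//; last first.
      by apply/measurable_EFinP; exact: measurable_indic.
    rewrite integral_indic// setIT lee_wpmul2l//.
    apply: le_trans (ltW Pr) _; apply: le_measure; rewrite ?inE//.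
      exact: (measurable_funPTI Z mG).
    by move=> w; exact: Gbox.
  apply: ge0_le_integral => //.
  - apply: measurable_funeM; apply/measurable_EFinP; exact: measurable_indic.
  - exact: measurable_probability_section.
  move=> u _; rewrite indicE; case: (boolP (u \in S)); last by rewrite mule0.
  rewrite inE mule1 => Su.
  apply: le_trans (@observed_ge _ _ _ _ _ _ _ gZ _ mE i0 s c r e _ G (Z u) mG
    Gbox r0 (ltW c0) _ _ eC erefl Pr Su _) _.
  - apply: le_trans m1; apply: le_trans H1; nra.
  - apply: le_trans me; apply: le_trans H2; nra.
  - apply: Efull => // l l1; by rewrite /slope ltnNge l1.
  - apply: le_measure; rewrite ?inE.
    + apply: measurable_funPTI; apply: measurableI => //.
      exact: measurable_section_l (mseen s).
    + exact: measurable_section_l.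
    + by move=> w [].
have L3 : (\int[P]_u P [set w | Q 0%R (r + 1)%R (u, w)] <= (1/5)%:E)%E.
  apply: (@le_trans _ _ (\int[P]_u (cst (1/5)%:E u))%E); last first.
    by rewrite integral_cst//= probability_setT mule1.
  apply: ge0_le_integral => //.
    exact: measurable_probability_section.
  move=> u _ /=; have [Bu|nBu] := pselect (box (r + 1) (Z u)); last first.
    rewrite [X in P X](_ : _ = set0) ?measure0 ?lee_fin//.
    by apply/seteqP; split => w //= [].
  apply: le_trans (@observed_le _ _ _ _ _ _ _ gZ _ mE i0 c r e _ G (Z u) mG
    Gbox r0 (ltW c0) _ _ eC erefl Bu _).
  - apply: le_measure; rewrite ?inE.
    + exact: measurable_section_l.
    + apply: measurable_funPTI; apply: measurableI => //.
      exact: measurable_section_l (mseen 0).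
    + by move=> w [].
  - exact: le_trans H1 m1.
  - exact: le_trans H2 me.
  - by apply: Esing => l l1; rewrite /slope ltnNge l1.
(* For a fixed [w] in [G] the vector [k] is fixed too, so the change of slopes is a constant shift
   [D] of the Gaussian variables of the other copy; [obs_absorb] turns the noisy observation into
   the noiseless one. *)
have L2 : (\int[P]_w P [set u | Q s r (u, w)] <=
    (11/10)%:E * \int[P]_w P [set u | Q 0%R (r + 1)%R (u, w)])%E.
  rewrite -ge0_integralZl_EFin//; last exact: measurable_probability_section_r.
  apply: ge0_le_integral => //.
    exact: measurable_probability_section_r.
    by apply: measurable_funeM; exact: measurable_probability_section_r.
  move=> w _; have [Gw|nGw] := pselect (G (Z w)); last first.
    rewrite [X in P X](_ : _ = set0) ?measure0 ?mule_ge0 ?lee_fin//.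
    by apply/seteqP; split => u //= [_ []].
  pose k := (\det (W (Z w)))^-1 *: a (Z w).
  pose D (q : 'I_n * 'I_p.+2) (_ : n.-tuple (p.+2.-tuple R)) := s / c * \sum_j
    (k j 0 *+ (col j == q.2)).
  pose A := [set y | box (r + 1) y /\ E (obs 0 (slope c i0 y) (Z w))].
  have mA : measurable A by apply: measurableI => //;
    exact: measurable_section_r (mseen 0).
  have [det1 phir] := Gw.
  have det0 : \det (W (Z w)) != 0.
    by apply/eqP => d0; move: det1; rewrite d0 normr0 mulr0 ler10.
  have Wk : W (Z w) *m k = x (Z w).
    by rewrite -scalemxAr mulmxA mul_mx_adj mul_scalar_mx scalerA mulVf//
      scale1r.
  have Dr q y : `|D q y| <= c * r ^+ 2.
    rewrite /D scE normrM (gtr0_norm c0) ler_wpM2l ?(ltW c0)//.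
    apply: (@le_trans _ _ (\sum_j r * `|a (Z w) j 0|)).
      rewrite (le_trans (ler_norm_sum _ _ _))// ler_sum// => j _.
      rewrite normrMn mxE normrM; apply: (@le_trans _ _ (`|(\det (W (Z w)))^-1|
        * `|a (Z w) j 0|)).
        by case: eqP; rewrite ?mulr1n// mulr0n mulr_ge0.
      by rewrite ler_wpM2r// normfV -[_^-1]mul1r ler_pdivrMr ?normr_gt0.
    rewrite -mulr_sumr expr2 ler_wpM2l//; apply: le_trans phir.
    by rewrite /phi lerDr sumr_ge0.
  apply: (@le_trans _ _ (P (Z @^-1` (shift_coord (tail_coords n p) D @^-1`
    A)))).
    apply: le_measure; rewrite ?inE.
    - exact: measurable_section_r.
    - apply: measurable_funPTI; rewrite -[X in measurable X]setTI.
      apply: (@measurable_shift_coord R n p.+2 (tail_coords n p) D _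
        measurableT _ mA).
      by move=> q; exact: measurable_cst.
    - move=> u [/= Bu [Eu _]]; split.
        move=> q; rewrite of_coordK (le_trans (ler_normD _ _))// lerD//.
        case: ifP => _; last by rewrite normr0.
        by rewrite (le_trans (Dr _ (Z u)))// (le_trans H3).
      by rewrite /D -(@obs_absorb R n p s c i0 col (Z u) (Z w) k)// gt_eqF.
  apply: (le_trans (gaussian_shift gZ (e := e) (enum_uniq _) mA _ _ _)).
  - by move=> q; exact: measurable_cst.
  - by [].
  - move=> z q [Bz _] _; apply: le_trans me; apply: le_trans H4.
    by apply: ler_pM => //; exact: Dr.
  rewrite lee_pmul ?lee_fin ?expR_ge0//.
  apply: le_measure; rewrite ?inE.
  - exact: measurable_funPTI.
  - exact: measurable_section_r.
  - by move=> u [Bu Eu].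
(* This would mean 0.475 <= 0.22. *)
have : ((1/2)%:E * (95/100)%:E <= (11/10)%:E * (1/5)%:E :> \bar R)%E.
  apply: (le_trans L1); rewrite section_probability_swap//.
  apply: (le_trans L2); rewrite -section_probability_swap//.
  by rewrite lee_wpmul2l.
by rewrite -!EFinM lee_fin; lra.
Qed.

(** * The covariance matrices *)

(** With [w = S v], positivity at [v - t w] reads [0 <= t^2 q - 2 t a], where [a = |w|^2]. This
    fails for small [t > 0] unless [a = 0]. *)
Lemma psd_quad_eq0 (R : realType) (d : nat) (S : 'M[R]_d) (v : 'cV[R]_d) :
  psd S -> (v^T *m S *m v) 0 0 = 0 -> S *m v = 0.
Proof.
move=> [ST S0] vSv.
pose w := S *m v.
have wT : w^T = v^T *m S by rewrite /w trmx_mul ST.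
pose a := (w^T *m w) 0 0; pose q := (w^T *m S *m w) 0 0.
have aE : a = \sum_i w i 0 ^+ 2.
  by rewrite /a mxE; apply: eq_bigr => i _; rewrite mxE expr2.
have a0 : 0 <= a by rewrite aE sumr_ge0// => i _; exact: sqr_ge0.
have q0 : 0 <= q by exact: S0.
have expand t : 0 <= t ^+ 2 * q - 2 * t * a.
  have := S0 (v - t *: w).
  suff -> : ((v - t *: w)^T *m S *m (v - t *: w)) 0 0 = t ^+ 2 * q - 2 * t * a
    by [].
  have vSw : (v^T *m S *m w) 0 0 = a by rewrite -wT.
  have wSv : (w^T *m S *m v) 0 0 = a by rewrite -mulmxA.
  have -> : (v - t *: w)^T *m S *m (v - t *: w) =
     v^T *m S *m v - t *: (v^T *m S *m w) - t *: (w^T *m S *m v) + t ^+ 2 *: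
       (w^T *m S *m w).
    have -> : (v - t *: w)^T = v^T - t *: w^T by apply/matrixP => i j;
      rewrite !mxE.
    rewrite !(mulmxBl, mulmxBr) -!scalemxAl -!scalemxAr -?scalemxAl scalerA
      -expr2.
    by rewrite opprB addrA [LHS]addrAC; congr (_ + _); rewrite addrAC.
  move: vSv vSw wSv; rewrite /q; set X1 := _ *m v; set X2 := _ *m w;
    set X3 := w^T *m _ *m v; set X4 := w^T *m S *m w.
  by rewrite !mxE => -> -> ->; ring.
have a_0 : a = 0.
  have t0 : 0 < (q + 1)^-1 by rewrite invr_gt0 ltr_wpDl.
  (* At this [t] the expression equals [- a^2 (q + 2) / (q + 1)^2]; the added 1 covers the case
     [q = 0]. *)
  have := expand (a / (q + 1)).
  have -> : (a / (q + 1)) ^+ 2 * q - 2 * (a / (q + 1)) * a =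
     - (a ^+ 2 * ((q + 1)^-1 ^+ 2 * (q + 2))) by field;
         rewrite gt_eqF// ltr_wpDl.
  rewrite oppr_ge0 => h.
  have : 0 < (q + 1)^-1 ^+ 2 * (q + 2).
    by rewrite mulr_gt0 ?exprn_gt0// ltr_wpDl.
  move=> k0; apply/eqP; rewrite -sqrf_eq0; apply/eqP/le_anti;
    rewrite sqr_ge0 andbT.
  by rewrite -(pmulr_lle0 _ k0).
apply/matrixP => i j; rewrite ord1 -/w [RHS]mxE.
move/eqP: a_0; rewrite aE psumr_eq0; last by move=> k _; exact: sqr_ge0.
by move=> /allP /(_ i (mem_index_enum _)); rewrite /= sqrf_eq0 => /eqP.
Qed.

(** For [D = S - S'] one has [S D + D S' = 0], so the traces of [D S D] and [D S' D] add up to 0.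
    Their diagonal entries are nonnegative, hence all vanish, which gives [S D = S' D = 0]. Then
    [D^2 = 0], and [D] is symmetric. *)
Lemma psd_sqr_inj (R : realType) (d : nat) (S S' : 'M[R]_d) :
  psd S -> psd S' -> S *m S = S' *m S' -> S = S'.
Proof.
move=> pS pS' SS.
have [ST S0] := pS; have [ST' S0'] := pS'.
have [D DE] : exists D, D = S - S' by exists (S - S').
have DT : D^T = D by rewrite DE; apply/matrixP => i j;
  rewrite !mxE -{1}ST -{1}ST' !mxE.
have H : S *m D + D *m S' = 0.
  by rewrite DE mulmxBr mulmxBl SS addrA subrK subrr.
have quad (Y : 'M[R]_d) i : (D *m Y *m D) i i = ((col i D)^T *m Y *m (col i D))
  0 0.
  rewrite -{1}DT !mxE; apply: eq_bigr => j _; rewrite !mxE; congr (_ * _).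
  by apply: eq_bigr => k _; rewrite !mxE.
have tr0 : \sum_i (D *m S *m D) i i + \sum_i (D *m S' *m D) i i = 0.
  have -> : \sum_i (D *m S' *m D) i i = \tr (D *m (D *m S')) by rewrite
    mxtrace_mulC.
  rewrite -[X in X + _]/(\tr (D *m S *m D)) -mulmxA -mxtraceD -mulmxDr H mulmx0.
  by rewrite mxtrace0.
have kill (Y : 'M[R]_d) : psd Y -> \sum_i (D *m Y *m D) i i = 0 -> Y *m D = 0.
  move=> pY /eqP; rewrite psumr_eq0; last by move=> i _; rewrite quad;
    exact: pY.2.
  move=> /allP Y0; apply/matrixP => i j.
  have := psd_quad_eq0 pY (v := col j D).
  rewrite -quad => /(_ (eqP (Y0 j (mem_index_enum _)))).
  have -> : Y *m col j D = col j (Y *m D).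
    by apply/matrixP => k l; rewrite !mxE; apply: eq_bigr => ? _; rewrite !mxE.
  by move=> /matrixP /(_ i 0); rewrite !mxE.
have sum_ge0 (Y : 'M[R]_d) : psd Y -> 0 <= \sum_i (D *m Y *m D) i i.
  by move=> pY; apply: sumr_ge0 => i _; rewrite quad; exact: pY.2.
move/eqP: tr0; rewrite paddr_eq0 ?sum_ge0// => /andP[/eqP /(kill _ pS) SD /eqP
  /(kill _ pS') SD'].
have DD : D *m D = 0 by rewrite {1}DE mulmxBl SD SD' subrr.
apply/eqP; rewrite -subr_eq0; apply/eqP/matrixP => i j; rewrite -DE [RHS]mxE.
have : \sum_k D k j ^+ 2 = 0.
  transitivity ((D^T *m D) j j); last by rewrite DT DD mxE.
  by rewrite mxE; apply: eq_bigr => k _; rewrite mxE expr2.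
move/eqP; rewrite psumr_eq0; last by move=> k _; exact: sqr_ge0.
by move=> /allP /(_ i (mem_index_enum _)); rewrite /= sqrf_eq0 => /eqP.
Qed.

Lemma psd_sqr (R : realType) (d : nat) (S : 'M[R]_d) : psd S -> psd (S *m S).
Proof.
move=> [ST _]; split; first by rewrite trmx_mul ST.
move=> x; have -> : x^T *m (S *m S) *m x = (S *m x)^T *m (S *m x).
  by rewrite trmx_mul ST !mulmxA.
by rewrite mxE sumr_ge0// => i _; rewrite mxE -expr2 sqr_ge0.
Qed.

Lemma psd_sqrtK (R : realType) (d : nat) (S : 'M[R]_d) :
  psd S -> psd_sqrt (S *m S) = S.
Proof.
move=> pS; rewrite /psd_sqrt; case: xgetP => [S' _ [pS' SS]|].
  exact: psd_sqr_inj.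
by move=> /(_ S) /= [].
Qed.

(** * The matrices of the model *)

Definition shear_mx (R : realType) (p : nat) (b : 'I_p.+2 -> R) : 'M[R]_p.+2 :=
  1%:M + \matrix_(i, j) (b i *+ (j == ord0)).

Definition weight (R : realType) (p : nat) (s : R) (i : 'I_p.+2) : R :=
  if val i == 0%N then s else if val i == 1%N then 0 else 1.

Definition model_root (R : realType) (p : nat) (s : R) (b : 'I_p.+2 -> R) :
    'M[R]_p.+2 :=
  (shear_mx b)^T *m diag_mx (\row_i weight s i) *m shear_mx b.

Lemma model_root_psd (R : realType) (p : nat) (s : R) (b : 'I_p.+2 -> R) :
  0 <= s -> psd (model_root s b).
Proof.
move=> s0; split.
  by rewrite /model_root !trmx_mul trmxK tr_diag_mx mulmxA.
move=> x; pose y := shear_mx b *m x.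
have -> : x^T *m model_root s b *m x = y^T *m (diag_mx (\row_i weight s i) *m
  y).
  by rewrite /model_root /y trmx_mul !mulmxA.
rewrite mxE sumr_ge0// => i _; rewrite mul_diag_mx !mxE mulrCA -expr2.
rewrite mulr_ge0 ?sqr_ge0// /weight; by case: ifP => // _; case: ifP.
Qed.

Lemma model_rootE (R : realType) (p : nat) (s : R) (b : 'I_p.+2 -> R)
    (x : 'cV[R]_p.+2) i : (forall l : 'I_p.+2, (l <= 1)%N -> b l = 0) ->
  (model_root s b *m x) i 0 =
  if val i == 0%N then s * x i 0 + \sum_l b l * (x l 0 + b l * x ord0 0)
  else if val i == 1%N then 0 else x i 0 + b i * x ord0 0.
Proof.
move=> b0.
have shearE j : (shear_mx b *m x) j 0 = x j 0 + b j * x ord0 0.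
  rewrite mulmxDl mul1mx mxE; congr (_ + _);
    rewrite mxE (bigD1 ord0)//= mxE eqxx mulr1n.
  by rewrite big1 ?addr0// => k /negbTE k0; rewrite mxE k0 mulr0n mul0r.
have trE (y : 'cV[R]_p.+2) j : ((shear_mx b)^T *m y) j 0 =
    y j 0 + (\sum_l b l * y l 0) *+ (j == ord0).
  rewrite linearD/= trmx1 mulmxDl mul1mx mxE; congr (_ + _); rewrite mxE.
  case: eqP => [->|/eqP /negbTE j0].
    by rewrite mulr1n; apply: eq_bigr => k _; rewrite !mxE eqxx mulr1n.
  by rewrite big1// => k _; rewrite !mxE j0 mulr0n mul0r.
have diagE (y : 'cV[R]_p.+2) j :
    (diag_mx (\row_i weight s i) *m y) j 0 = weight s j * y j 0.
  by rewrite mul_diag_mx !mxE.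
rewrite /model_root -!mulmxA trE diagE shearE /weight.
have -> : \sum_l b l * (diag_mx (\row_i weight s i) *m (shear_mx b *m x)) l 0 =
    \sum_l b l * (x l 0 + b l * x ord0 0).
  apply: eq_bigr => l _; rewrite diagE shearE /weight.
  case: ifPn => [/eqP l0|l0]; first by rewrite b0 ?mul0r// l0.
  by case: ifPn => [/eqP l1|l1]; [rewrite b0 ?mul0r// l1|rewrite mul1r].
have -> : (i == ord0) = (val i == 0%N) by [].
case: ifPn => [/eqP i0|i0].
  by rewrite mulr1n; congr (_ * _ + _); rewrite b0 ?i0// mul0r addr0.
by rewrite mulr0n addr0; case: ifPn => _; rewrite ?mul0r// mul1r.
Qed.

Lemma mxact_model_root (R : realType) (n p : nat) (s : R) (b : 'I_p.+2 -> R)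
    (z : n.-tuple (p.+2.-tuple R)) : (forall l : 'I_p.+2, (l <= 1)%N -> b l =
      0) ->
  [tuple mxact (model_root s b) (tnth z i) | i < n] = obs s b (shear b z).
Proof.
move=> b0; apply: coord_inj => -[i l]; rewrite of_coordK /=.
transitivity ((model_root s b *m \col_j coord z (i, j)) l 0).
  by rewrite /coord /= !tnth_mktuple.
rewrite model_rootE// !mxE.
case: ifPn => [/eqP l0|l0].
  rewrite shearE/= l0 addr0; congr (_ + _).
  apply: eq_bigr => k _; rewrite shearE/= !mxE.
  by case: ifPn => // k1; rewrite b0 ?mul0r// leqNgt.
case: ifPn => [//|l1]; rewrite shearE/=.
by case: l l0 l1 => -[|[|l]].
Qed.

(** * Segments, their variance, and the ellipses of the model *)

Lemma uniform_law_segment (R : realType) (r : R) (J : set (measurableTypeR R)) :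
  0 < r ->
  uniform_law lebesgue_measure (`[- r, r]%classic : set (measurableTypeR R)) 0
    J =
  (lebesgue_measure (J `&` `[(- r)%R, r]) * ((r *+ 2)^-1)%:E)%E.
Proof.
move=> r0; rewrite /uniform_law; case: pselect => [mI|[]];
  last exact: measurable_itv.
have muI : mrestr lebesgue_measure mI setT = (r *+ 2)%:E.
  rewrite /mrestr setTI lebesgue_measure_itv/= lte_fin -subr_gt0 opprK
    addr_gt0//.
rewrite /= /mnormalize; case: ifPn => [|_]; last by rewrite [X in fine X]muI.
by rewrite [X in X == 0%E]muI [X in X == +oo%E]muI orbF eqe mulrn_eq0/= gt_eqF.
Qed.

(** The number [m] is arbitrary, so that the mean never has to be computed: [(a t - m)^2 >= t^2] on
    the half of the segment where [a t] and [m] have opposite signs. *)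
Lemma variance_segment_neq0 (R : realType) (r a m : R) : 0 < r -> a ^+ 2 = 1 ->
  fine (\int[uniform_law lebesgue_measure
    (`[(- r)%R, r]%classic : set (measurableTypeR R)) 0%R]_t ((a * t - m) ^+
      2)%:E)%E != 0.
Proof.
move=> r0 a1.
set nu := uniform_law _ _ _.
have nuE J : nu J = (lebesgue_measure (J `&` `[(- r)%R, r]) * ((r *+
  2)^-1)%:E)%E.
  exact: uniform_law_segment.
pose f (t : measurableTypeR R) := (a * t - m) ^+ 2.
have mf : measurable_fun setT (EFin \o f).
  apply/measurable_EFinP; apply: measurable_funX; apply: measurable_funB => //.
have f0 t : (0 <= (f t)%:E)%E by rewrite lee_fin sqr_ge0.
(* Finiteness matters because [fine] sends [+oo] to 0. *)
have fin : (\int[nu]_t (f t)%:E < +oo)%E.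
  apply: (@le_lt_trans _ _ (((r + `|m|) ^+ 2)%:E * nu setT)%E).
    under eq_integral do rewrite -(gee0_abs (f0 _)).
    apply: integral_le_bound => //; first by rewrite lee_fin sqr_ge0.
    exists (~` `[- r, r]%classic); split.
    - by apply: measurableC; exact: measurable_itv.
    - apply: (eq_trans (nuE _)).
      by rewrite setICl measure0 mul0e.
    - move=> t /= nt; apply: contra_not nt => /=.
      rewrite in_itv/= -ler_norml => tr _; rewrite lee_fin.
      rewrite /f normrX ler_pXn2r ?nnegrE// ?addr_ge0// ?(ltW r0)//.
      rewrite (le_trans (ler_normB _ _))// lerD2r normrM.
      have -> : `|a| = 1 by apply/eqP; rewrite -sqrp_eq1// real_normK
        ?num_real// a1.
      by rewrite mul1r.
  by rewrite probability_setT mule1 ltry.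
have pos : (0 < \int[nu]_t (f t)%:E)%E.
  (* The outer quarter of the segment on the side where [t (a m) <= 0]; there the integrand is at
     least [(r / 2)^2]. *)
  pose J : set (measurableTypeR R) :=
    if 0 <= a * m then `[- r, - (r / 2)]%classic else `[r / 2, r]%classic.
  have mJ : measurable J by rewrite /J; case: ifP => _; exact: measurable_itv.
  have nuJ : nu J = (1/4)%:E.
    apply: (eq_trans (nuE _)); rewrite setIidl; last first.
      by rewrite /J; case: ifP => _ t /=; rewrite !in_itv/= => /andP[t1 t2];
        apply/andP; split; lra.
    have -> : lebesgue_measure J = (r / 2)%:E.
      rewrite /J; case: ifP => _; rewrite lebesgue_measure_itv/= lte_fin.
        have -> : - r < - (r / 2) by lra.
        by rewrite -?EFinD; congr EFin; field.
      have -> : r / 2 < r by lra.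
      by rewrite -?EFinD; congr EFin; field.
    by rewrite -EFinM; congr EFin; field; rewrite gt_eqF.
  apply: (@lt_le_trans _ _ (\int[nu]_(t in J) (cst ((r / 2) ^+ 2)%:E t))%E).
    rewrite integral_cst//; apply: (@lt_le_trans _ _ (((r / 2) ^+ 2)%:E *
      (1/4)%:E)%E).
      by rewrite -EFinM lte_fin mulr_gt0// exprn_gt0// divr_gt0.
    by rewrite -nuJ.
  apply: (@le_trans _ _ (\int[nu]_(t in J) (f t)%:E)%E);
    last exact: ge0_subset_integral.
  apply: ge0_le_integral => //.
  - by move=> t _; rewrite lee_fin sqr_ge0.
  - exact: measurable_funS mf.
  - move=> t Jt; rewrite lee_fin.
    have -> : f t = t ^+ 2 - 2 * (t * (a * m)) + m ^+ 2.
      by rewrite /f sqrrB exprMn a1; ring.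
    have m2 : 0 <= m ^+ 2 by exact: sqr_ge0.
    move: Jt; rewrite /J; case: ifPn => am /=; rewrite in_itv/= => /andP[t1 t2].
      by nra.
    by rewrite -ltNge in am; nra.
by rewrite fine_eq0 ?gt_eqF// ge0_fin_numE// ltW.
Qed.

(** The image of [x] lies in [E] exactly when every [w_l] vanishes, that is [x_l = - b_l x_0] for
    [l >= 2]; it is then [(s x_0, 0)], and [t] is [x_0]. The root ignores [x_1], which is best taken
    to be 0, and the norm condition becomes the one on [t]. *)
Lemma ellipse_model_rootP (R : realType) (p : nat) (s : R) (b : 'I_p.+2 -> R)
    (q : R * R) : 0 <= s -> (forall l : 'I_p.+2, (l <= 1)%N -> b l = 0) ->
  ellipse (model_root s b *m model_root s b) q <->
  exists2 t, q = (s * t, 0) & t ^+ 2 * (1 + \sum_l b l ^+ 2) <= 1.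
Proof.
move=> s0 b0; rewrite /ellipse psd_sqrtK; last exact: model_root_psd.
have normE (x : p.+2.-tuple R) : \sum_i tnth x i ^+ 2 =
   tnth x ord0 ^+ 2 + \sum_(i | i != ord0) tnth x i ^+ 2 by rewrite (bigD1
     ord0).
have bE : \sum_l b l ^+ 2 = \sum_(l | l != ord0) b l ^+ 2.
  by rewrite (bigD1 ord0)//= b0// expr0n add0r.
split.
- move=> [x xB xq].
  have xqi i : tnth (mxact (model_root s b) x) i = tnth (plane_vec p.+2 q) i by
    rewrite xq.
  have xl (l : 'I_p.+2) : (1 < l)%N -> tnth x l = - b l * tnth x ord0.
    move=> l1; have := xqi l; rewrite !tnth_mktuple model_rootE// !mxE.
    have /negbTE -> : val l != 0%N by rewrite -lt0n ltnW.
    have /negbTE -> : val l != 1%N by rewrite neq_ltn l1 orbT.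
    by move=> /eqP; rewrite addr_eq0 mulNr => /eqP.
  exists (tnth x ord0).
    have q2 : q.2 = 0.
      have := xqi (lift ord0 ord0); rewrite !tnth_mktuple model_rootE//=.
    have q1 : q.1 = s * tnth x ord0.
      have := xqi ord0; rewrite !tnth_mktuple model_rootE//= !mxE => <-.
      rewrite big1 ?addr0// => l _; rewrite !mxE; case: (leqP l 1) => l1.
        by rewrite b0// mul0r.
      by rewrite (xl l l1) mulNr addNr mulr0.
    by rewrite -q1 -q2 -surjective_pairing.
  apply: le_trans xB; rewrite normE mulrDr mulr1 bE lerD2l mulr_sumr.
  apply: ler_sum => l _; case: (leqP l 1) => l1.
    by rewrite b0// expr0n mulr0 sqr_ge0.
  by rewrite (xl l l1) exprMn sqrrN mulrC.
- move=> [t -> tB].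
  exists [tuple if val i == 0%N then t else - b i * t | i < p.+2].
    rewrite /euclidean_ball/= normE tnth_mktuple/=; apply: le_trans tB.
    rewrite mulrDr mulr1 bE lerD2l mulr_sumr ler_sum// => l l0.
    by rewrite tnth_mktuple -[val l == _]/(l == ord0) (negbTE l0) exprMn sqrrN
      mulrC.
  apply: eq_from_tnth => i; rewrite !tnth_mktuple model_rootE// !mxE
    !tnth_mktuple.
  case: (boolP (val i == 0%N)) => [i0|i0].
    rewrite big1 ?addr0// => l _; rewrite !mxE !tnth_mktuple/=;
      case: ifPn => [/eqP l0|l0].
      by rewrite b0 ?l0// mul0r.
    by rewrite mulNr addNr mulr0.
  by case: ifPn => // _; rewrite ?(negbTE i0) mulNr addNr.
Qed.

Lemma CE_point (R : realType) (d : nat) (A : 'M[R]_d) :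
  ellipse A `<=` [set (0, 0)] -> \rank (CE A) = 0%N.
Proof.
move=> A0; suff -> : CE A = 0 by rewrite mxrank0.
apply/matrixP => i j; rewrite !mxE /uniform_distribution; case: pselect => // _.
have p0 k : plane_coord k (0, 0) = 0 :> R by rewrite /plane_coord; case: ifP.
have mp k : measurable_fun setT (plane_coord k : plane R -> R).
  rewrite /plane_coord; case: (k == 0); [exact: measurable_fst|exact:
    measurable_snd].
have E0 k : ('E_(dirac ((0%R, 0%R) : plane R))[plane_coord k] = 0)%E.
  rewrite unlock integral_dirac//; first by rewrite diracT mul1e p0.
  exact/measurable_EFinP.
rewrite unlock !E0/= unlock integral_dirac//.
  rewrite diracT mul1e.
  rewrite -[LHS]/((plane_coord i (0, 0) - 0) * (plane_coord j (0, 0) - 0)).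
  by rewrite !p0 !subr0 mul0r.
apply/measurable_EFinP; apply: measurable_funM; exact: measurable_funB.
Qed.

(** One nonzero entry is enough, and the entry (0, 0) is the variance of the first coordinate along
    the segment. *)
Lemma CE_segment (R : realType) (d : nat) (A : 'M[R]_d) (r : R) : 0 < r ->
  (forall q, ellipse A q <-> q.2 = 0 /\ `|q.1| <= r) -> \rank (CE A) <> 0%N.
Proof.
move=> r0 Aq /eqP; rewrite mxrank_eq0 => /eqP /matrixP /(_ ord0 ord0).
rewrite !mxE /uniform_distribution.
have Ar : ellipse A (r, 0) by apply/Aq; rewrite /= gtr0_norm.
case: pselect => [/(_ _ Ar) [/eqP]|_]; first by rewrite gt_eqF.
case: pselect => [ex_u|[]]; last first.
  exists (1, 0); split; first by rewrite expr1n expr0n addr0.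
  by move=> [q1 q2] /Aq /= [-> _]; exists q1 => //; rewrite /line/= mulr1 mulr0.
(* The unit vector comes from a choice, but its line contains [(r, 0)], which forces it to be
   [(1, 0)] or [(-1, 0)]. *)
case: (cid ex_u) => -[a b] /= [ab Kab].
have [t _ [ta tb]] := Kab _ Ar.
have t0 : t != 0.
  by apply: contra_eq_neq ta => ->; rewrite /= mul0r lt_eqF.
have b0 : b = 0 by move/eqP: tb; rewrite mulf_eq0 (negbTE t0) => /eqP.
have a1 : a ^+ 2 = 1 by move: ab; rewrite b0 expr0n addr0.
have aN : `|a| = 1 by apply/eqP; rewrite -sqrp_eq1// real_normK ?num_real// a1.
have KE : line (a, b) @^-1` ellipse A = `[- r, r]%classic.
  apply/seteqP; split => u /=.
    by move=> /Aq /= [_]; rewrite normrM aN mulr1 in_itv/= -ler_norml.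
  rewrite in_itv/= -ler_norml => ur; apply/Aq; rewrite /= b0 mulr0; split => //.
  by rewrite normrM aN mulr1.
rewrite /uniform_on_line KE.
set nu := uniform_law _ _ _.
rewrite unlock; set m := (X in cst X); rewrite unlock.
apply/eqP.
rewrite (_ : integral _ _ _ = (\int[nu]_t ((a * t - m) ^+ 2)%:E)%E).
  exact: variance_segment_neq0.
rewrite ge0_integral_distribution.
- apply: eq_integral => u _ /=.
  by rewrite /line /= -[X in EFin X]/((u * a - m) * (u * a - m)) -expr2 mulrC.
- apply/measurable_EFinP; apply: measurable_funM;
    apply: measurable_funB => //; exact: measurable_fst.
- by move=> q; rewrite lee_fin -[X in 0 <= X]/((q.1 - m) * (q.1 - m)) -expr2
    sqr_ge0.
Qed.

Lemma CE_model_root0 (R : realType) (p : nat) (b : 'I_p.+2 -> R) :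
  (forall l : 'I_p.+2, (l <= 1)%N -> b l = 0) ->
  \rank (CE (model_root 0 b *m model_root 0 b)) = 0%N.
Proof.
move=> b0; apply: CE_point => q /(ellipse_model_rootP q (lexx 0) b0).
by move=> [t -> _]; rewrite mul0r.
Qed.

Lemma CE_model_root (R : realType) (p : nat) (s : R) (b : 'I_p.+2 -> R) :
  0 < s -> (forall l : 'I_p.+2, (l <= 1)%N -> b l = 0) ->
  \rank (CE (model_root s b *m model_root s b)) <> 0%N.
Proof.
move=> s0 b0; pose k := Num.sqrt (1 + \sum_l b l ^+ 2).
have k2 : k ^+ 2 = 1 + \sum_l b l ^+ 2.
  by rewrite sqr_sqrtr// addr_ge0// sumr_ge0// => l _; exact: sqr_ge0.
have k0 : 0 < k.
  by rewrite sqrtr_gt0 ltr_wpDr// sumr_ge0// => l _; exact: sqr_ge0.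
(* The parameter [t] of the segment runs over [|t| <= 1 / k], whence the half-length. *)
apply: (@CE_segment _ _ _ (s / k)); first by rewrite divr_gt0.
move=> q; split.
  move=> /(ellipse_model_rootP q (ltW s0) b0) [t -> /=]; rewrite -k2 => tk;
    split=> //.
  rewrite normrM gtr0_norm// ler_pM2l// -[k^-1]mul1r ler_pdivlMr//.
  by rewrite -(ler_pXn2r (_ : 0 < 2)%N)// ?nnegrE ?mulr_ge0 ?(ltW k0)// exprMn
    real_normK ?num_real// expr1n.
move=> [q2 q1]; apply/(ellipse_model_rootP q (ltW s0) b0); exists (q.1 / s).
  by rewrite mulrC divfK ?gt_eqF// -q2 -surjective_pairing.
rewrite -k2 -exprMn -real_normK ?num_real// exprn_ile1//.
rewrite !normrM normfV (gtr0_norm s0) (gtr0_norm k0) mulrAC ler_pdivrMr// mul1r.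
by rewrite -ler_pdivlMr.
Qed.

(** * From a statistic estimating the rank to a contradiction *)

Lemma gaussian_sample_of (R : realType) (n d : nat) (dT : measure_display)
    (T : measurableType dT) (P : probability T R) (X : 'I_n -> {RV P >->
      d.-tuple R})
    (Z : {RV P >-> n.-tuple (d.-tuple R)}) :
  (forall i, standard_gaussian (X i)) -> mutually_independent X ->
  (forall w i, tnth (Z w) i = X i w) -> gaussian_sample Z.
Proof.
move=> gX iX ZX B mB.
pose B' (i : 'I_n) : set (d.-tuple R) := [set x | forall l, B (i, l) (tnth x
  l)].
have mB' i : measurable (B' i).
  rewrite (_ : B' i = \bigcap_(l in [set: 'I_d]) ((fun x => tnth x l) @^-1` B
    (i, l))).
    apply: fin_bigcap_measurable => // l _.
    by rewrite -[X in measurable X]setTI;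
      exact: (@measurable_tnth _ R d l measurableT _ (mB (i, l))).
  by apply/seteqP; split => x /= xB l; [move=> _|]; exact: xB.
have := iX [set: 'I_n]%SET B' mB'.
rewrite (_ : \bigcap_(i in _) _ = Z @^-1` rectangle B); last first.
  apply/seteqP; split => w /= wB.
    by move=> [i l]; rewrite /coord /= ZX; apply: wB; rewrite /= inE.
  by move=> i _ l /=; rewrite -ZX; exact: (wB (i, l)).
move=> ->; under eq_bigl do rewrite inE.
rewrite (eq_bigr (fun i => \prod_l normal_prob 0 1 (B (i, l)))%E); last first.
  by move=> i _; exact: (gX i).
by rewrite pair_bigA/=; apply: eq_bigr => -[].
Qed.

Theorem theorem1p1 (R : realType) (d n : nat)
  (hd : (2 <= d)%N) (hn : (0 < n)%N) (hnd : (n%:R : R) < d%:R / 3%:R)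
  (dT : measure_display) (T : measurableType dT) (P : probability T R)
  (X : 'I_n -> {RV P >-> d.-tuple R})
  (X_gaussian : forall i, standard_gaussian (X i))
  (X_indep : mutually_independent X) :
  ~ exists F : n.-tuple (d.-tuple R) -> 'I_3,
      (forall k : 'I_3, measurable (F @^-1` [set k])) /\
      forall A : 'M[R]_d, psd A ->
        ((9%:R / 10%:R)%:E <
         P [set w | F [tuple mxact (psd_sqrt A) (X i w) | i < n]
                    = \rank (CE A) :> nat])%E.
Proof.
case: d => [//|[//|p]] in hd hnd X X_gaussian X_indep *.
move=> [F [mF FA]].
(* Here [d = p + 2], and [n >= 1] gives [n + 2 <= 3 n < p + 2]. *)
have np : (n <= p)%N.
  move: hnd; rewrite ltr_pdivlMr// -natrM ltr_nat => h.
  rewrite ltnW// -(ltn_add2r 2) addn2 addn2 -addn2 (leq_ltn_trans _ h)//.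
  by rewrite mulnS leq_add2l leq_pmull.
pose Zf w := [tuple X i w | i < n].
have mZf : measurable_fun setT Zf.
  apply/measurable_fun_tnthP => i.
  by apply: eq_measurable_fun (measurable_funP (X i)) => w _;
    rewrite /= tnth_mktuple.
pose Zm := isMeasurableFun.Build _ _ _ _ Zf mZf.
pose Z : {RV P >-> n.-tuple (p.+2.-tuple R)} := HB.pack Zf Zm.
have gZ : gaussian_sample Z.
  by apply: gaussian_sample_of X_gaussian X_indep _ => w i;
    rewrite tnth_mktuple.
(* The event that [F] does not answer 0: likely when [s > 0], unlikely when [s = 0]. *)
pose E : set (n.-tuple (p.+2.-tuple R)) := ~` (F @^-1` [set ord0]).
have mE : measurable E by apply: measurableC; exact: mF.
have mev (A : set (n.-tuple (p.+2.-tuple R))) s b : measurable A ->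
    measurable (Z @^-1` [set z | A (obs s b (shear b z))]).
  move=> mA; apply: measurable_funPTI; rewrite -[X in measurable X]setTI.
  have mobs : measurable_fun setT
      (obs s b \o shear b : n.-tuple (p.+2.-tuple R) -> n.-tuple (p.+2.-tuple
        R)).
    by apply: measurableT_comp; [exact: measurable_obs|exact: measurable_shear].
  exact: (mobs measurableT _ mA).
have observed s b w : 0 <= s -> (forall l : 'I_p.+2, (l <= 1)%N -> b l = 0) ->
    [tuple mxact (psd_sqrt (model_root s b *m model_root s b)) (X i w) | i < n]
      =
    obs s b (shear b (Z w)).
  move=> s0 b0; rewrite psd_sqrtK; last exact: model_root_psd.
  rewrite -mxact_model_root//; apply: eq_from_tnth => i.
  by rewrite !tnth_mktuple.
(* Treating every natural number [k], with an empty set from 3 on, avoids having to bound the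
   rank. *)
have rankP k : measurable [set z | F z = k :> nat].
  case: (ltnP k 3) => k3.
    rewrite (_ : [set z | _] = F @^-1` [set Ordinal k3])//.
    by apply/seteqP; split => z /=; [move=> Fk; exact/val_inj|move=> ->].
  rewrite (_ : [set z | _] = set0)//; apply/seteqP; split => z //= Fk.
  by have := ltn_ord (F z); rewrite Fk ltnNge k3.
apply: (indistinguishable (E := E) gZ _ mE).
- by rewrite hn np.
- move=> s b s0 b0.
  have := FA _ (psd_sqr (model_root_psd b (ltW s0))).
  move=> /lt_le_trans; apply; apply: le_measure; rewrite ?inE.
  + have := mev _ s b (rankP (\rank (CE (model_root s b *m model_root s b)))).
    congr measurable; apply/seteqP; split => w /=; rewrite observed// ltW//.
  + exact: mev.
  + move=> w /=; rewrite observed ?ltW// => Fr F0.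
    by apply: (CE_model_root s0 b0); rewrite -Fr F0.
- move=> b b0.
  have := FA _ (psd_sqr (model_root_psd b (lexx 0))).
  rewrite CE_model_root0//.
  set S := [set w | _]; have -> : S = Z @^-1` [set z | (F @^-1` [set ord0])
    (obs 0 b (shear b z))].
    apply/seteqP; split => w; rewrite /S /= observed//; first by move=> F0;
      exact/val_inj.
    by move=> ->.
  move=> SP; rewrite (_ : Z @^-1` _ = ~` (Z @^-1` [set z | (F @^-1` [set ord0])
    (obs 0 b (shear b z))])) //.
  have mS := mev _ 0 b (mF ord0).
  rewrite probability_setC//; move: SP.
  rewrite -(fineK (fin_num_measure P _ mS)) -EFinB lee_fin lte_fin; lra.
Qed.
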